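(* Let $G$ be a finite connected graph of rank $n\ge2$ with no univalent or bivalent vertices and no separating edges, and let $P=J(G)$. The map $p_{\mathscr C}:P\to\prod_{A\in\mathscr C}\mathbb P^A_{\ge0}$ is a stratum-preserving homeomorphism onto its image which restricts to a diffeomorphism on each stratum. Here $P$ and $\prod_{A\in\mathscr C}\mathbb P^A_{\ge0}$ are stratified by their open faces, and the image of $p_{\mathscr C}$ carries the stratification induced from $\prod_{A\in\mathscr C}\mathbb P^A_{\ge0}$.
   Context: **Core subsets.** Index the edges of $G$ by $\Delta=\{0,\dots,m\}$ and identify subgraphs (closures of sets of edges) with subsets of $\Delta$. A subgraph is core if removing any one of its open edges never increases its number of components; core subgraphs may be disconnected, and $G$ itself is core. $\mathscr C$ denotes the set of nonempty core subsets of $\Delta$. **Jewel.** Fix constants $0<c_1\ll c_2\ll\dots\ll c_n\ll1$ (sufficiently small depending on $n$, with $c_{r+1}>2c_r$). For $A\in\mathscr C$ let $c_A=c_r$ with $r=\operatorname{rank}H_1(A)$, and for $S\subseteq\Delta$ let $x_S=\sum_{i\in S}x_i$. The jewel is the convex polytope $$P=J(G)=\{x\in\mathbb R^{m+1}: x_i\ge0,\ x_\Delta=1,\ x_A\ge c_A\ \text{for all }A\in\mathscr C\}.$$ **The maps.** For $1\le r\le n-1$ let $g_r:[c_r,1]\to[0,1]$ be a smooth function with $g_r(c_r)=0$, strictly increasing on $[c_r,c_{r+1}]$, and constantly $1$ on $[c_{r+1},1]$. For $S\in\mathscr C\setminus\{\Delta\}$ put $g_S=g_{\operatorname{rank}H_1(S)}$.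 For $A\in\mathscr C$ define $\pi_A:P\to\mathbb R^A$ by $\pi_A(x)_i=x_i\prod_S g_S(x_S)$ for $i\in A$, the product being over all $S\in\mathscr C$ with $i\in S$ and $A\not\subseteq S$. The image of $\pi_A$ does not contain $0$, so composing with the projection to the real projective space $\mathbb P^A=P(\mathbb R^A)$ gives a map $p_A:P\to\mathbb P^A_{\ge0}$, where $\mathbb P^A_{\ge 0}$ is the set of points with nonnegative homogeneous coordinates (canonically a closed simplex with vertex set $A$). Put $p_{\mathscr C}=\prod_{A\in\mathscr C}p_A$. *)

(* Defs.v *)
From HB Require Import structures.
From mathcomp Require Import all_boot all_order all_algebra.
From mathcomp Require Import generic_quotient.
From mathcomp Require Import all_classical all_reals all_analysis.

Set Implicit Arguments.
Unset Strict Implicit.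
Unset Printing Implicit Defensive.

Import Order.TTheory GRing.Theory Num.Theory.
Import numFieldNormedType.Exports.

Local Open Scope ring_scope.

(* Finite graphs, with loops and multiple edges allowed.  The edge set is
   Delta = {0, ..., m}.  Each edge carries an arbitrary orientation, which only
   serves to name its two ends and to write down the cellular boundary map. *)
Record graph (m : nat) := Graph {
  vertex : finType;
  src : 'I_m.+1 -> vertex;
  tgt : 'I_m.+1 -> vertex }.

Section Graphs.
Context {m : nat} (G : graph m).
Implicit Types (A : {set 'I_m.+1}) (W : {set vertex G}) (i : 'I_m.+1).

(* The vertices of the closure of a set of edges. *)
Definition verts A : {set vertex G} :=
  [set v | [exists i in A, (v == src G i) || (v == tgt G i)]].

Definition adj A : rel (vertex G) := fun u v =>
  [exists i in A, ((u == src G i) && (v == tgt G i))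
               || ((u == tgt G i) && (v == src G i))].

(* Number of connected components of the graph with vertices W and edges A,
   when W contains all the ends of the edges in A. *)
Definition ncomp W A : nat := n_comp (adj A) W.

Definition connected_graph : bool := ncomp [set: vertex G] [set: 'I_m.+1] == 1%N.

(* Number of half-edges at v: a loop counts twice. *)
Definition valence (v : vertex G) : nat :=
  (#|[set i | src G i == v]| + #|[set i | tgt G i == v]|)%N.

Definition separating i : bool :=
  (ncomp [set: vertex G] [set: 'I_m.+1]
     < ncomp [set: vertex G] ([set: 'I_m.+1] :\ i))%N.

(* Cellular chain complex of the closure of A, with rational coefficients:
   the row of the edge i of A is tgt i - src i. *)
Definition boundary A : 'M[rat]_(#|A|, #|vertex G|) :=
  \matrix_(k, l) ((enum_val l == tgt G (enum_val k))%:R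
                  - (enum_val l == src G (enum_val k))%:R).

(* H_1(A) is the kernel of the boundary map, since there are no 2-cells, and
   its rank is the dimension of H_1(A; Q). *)
Definition h1rank A : nat := \rank (kermx (boundary A)).

Definition core A : bool :=
  [forall i in A, (ncomp (verts A) (A :\ i) <= ncomp (verts A) A)%N].

(* The set C of nonempty core subsets, as a finite type. *)
Definition coreset : finType :=
  {A : {set 'I_m.+1} | core A && (A != finset.set0)}.

End Graphs.

Local Open Scope classical_set_scope.

Section Smooth.
Context {R : realType}.

(* R^I is {ptws I -> R}: functions I -> R with the product topology. *)

Definition partial (I : finType) (i : I) (f : {ptws I -> R} -> R)
    (x : {ptws I -> R}) : R :=
  derive1 (fun t : R => f (fun j => if j == i then t else x j)) (x i).

(* U is meant to be open. *)
Fixpoint Ck (I : finType) (k : nat) (U : set {ptws I -> R})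
    (f : {ptws I -> R} -> R) : Prop :=
  match k with
  | 0%N => forall x, U x -> {for x, continuous f}
  | k'.+1 => forall i : I,
      (forall x, U x ->
         derivable (fun t : R => f (fun j => if j == i then t else x j)) (x i) 1)
      /\ Ck k' U (partial i f)
  end.

(* A map defined on an arbitrary subset X of R^I is smooth if near every point
   of X it extends to a smooth map defined on an open subset of R^I. *)
Definition smooth_on (I J : finType) (X : set {ptws I -> R})
    (f : {ptws I -> R} -> {ptws J -> R}) : Prop :=
  forall x, X x -> exists (U : set {ptws I -> R}) (F : {ptws I -> R} -> {ptws J -> R}),
    [/\ open U, U x,
        forall (j : J) (k : nat), Ck k U (fun y => F y j) &
        forall y, X y -> U y -> F y = f y].

Definition diffeo (I J : finType) (X : set {ptws I -> R}) (Y : set {ptws J -> R})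
    (f : {ptws I -> R} -> {ptws J -> R}) : Prop :=
  [/\ f @` X = Y, smooth_on X f &
      exists h : {ptws J -> R} -> {ptws I -> R},
        (forall x, X x -> h (f x) = x) /\ smooth_on Y h].

(* Smoothness on the closed interval [a, b], one-sided at the end points. *)
Definition smooth_itv (a b : R) (f : R -> R) : Prop :=
  exists F : R -> R,
    (forall (k : nat) (x : R), derivable (derive1n k F) x 1) /\
    {in `[a, b]%R, F =1 f}.

(* The functions g_r, for a = c_r and b = c_(r+1); only their values on [a, 1]
   matter. *)
Definition cutoff (a b : R) (h : R -> R) : Prop :=
  [/\ smooth_itv a 1 h,
      {in `[a, 1], forall x, 0 <= h x <= 1},
      h a = 0,
      {in `[a, b] &, {homo h : x y / x < y}} &
      {in `[b, 1], forall x, h x = 1}].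

End Smooth.

Definition homeo_onto_image (X Y : topologicalType) (K : set X) (f : X -> Y) :
    Prop :=
  {within K, continuous f} /\
  exists h : Y -> X,
    (forall x, K x -> h (f x) = x) /\ {within f @` K, continuous h}.

(* The stratification induced on a subset Y of a stratified space. *)
Definition induced_strata (T : Type) (S : set (set T)) (Y : set T) :
    set (set T) :=
  [set Z | Z !=set0 /\ exists2 W, S W & Z = Y `&` W].

(* f carries the strata of SX exactly onto the strata of SY. *)
Definition stratum_preserving (T U : Type) (SX : set (set T)) (SY : set (set U))
    (f : T -> U) : Prop :=
  (fun Z : set T => f @` Z) @` SX = SY.

Section Polytopes.
Context {R : realType} {I : finType}.
Implicit Types K F E : set {ptws I -> R}.

(* The nonempty faces of a convex polytope K: the sets of maximizers of linear
   functionals; a = 0 gives K itself. *)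
Definition face K F : Prop :=
  F !=set0 /\ exists a : I -> R,
    F = [set x | K x /\
           forall y, K y -> \sum_(i : I) a i * y i <= \sum_(i : I) a i * x i].

(* An open face is a face minus its proper subfaces. *)
Definition open_faces K : set (set {ptws I -> R}) :=
  [set E | exists2 F, face K F &
     E = F `\` \bigcup_(F' in [set F' | face K F' /\ F' `<` F]) F'].

End Polytopes.

Section Projective.
Context (R : realType) (I : finType).

Definition nonzero : set {ptws I -> R} := [set v | exists i, v i != 0].

Definition proportional (v w : nonzero) : bool :=
  `[< exists2 k : R, k != 0 & forall i, set_val w i = k * set_val v i >].

Lemma proportional_refl : reflexive proportional.
Proof. by move=> v; apply/asboolP; exists 1; rewrite ?oner_eq0// => i; rewrite mul1r. Qed.

Lemma proportional_sym : symmetric proportional.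
Proof.
have H v w : proportional v w -> proportional w v.
  move=> /asboolP[k k0 kE]; apply/asboolP; exists k^-1; rewrite ?invr_eq0// => i.
  by rewrite kE mulrA mulVf// mul1r.
by move=> v w; apply/idP/idP; exact: H.
Qed.

Lemma proportional_trans : transitive proportional.
Proof.
move=> v u w /asboolP[k k0 kE] /asboolP[l l0 lE]; apply/asboolP.
by exists (l * k); rewrite ?mulf_neq0// => i; rewrite lE kE mulrA.
Qed.

Canonical proportional_equiv :=
  EquivRel proportional proportional_refl proportional_sym proportional_trans.

(* P(R^I): the quotient of R^I minus the origin, with the quotient topology. *)
Definition proj_space : topologicalType :=
  quotient_topology {eq_quot proportional}%qT.

Definition line_of (v : nonzero) : proj_space := (\pi_proj_space v)%qT.

(* Only meaningful up to a nonzero scalar. *)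
Definition hcoord (q : proj_space) : {ptws I -> R} := set_val (repr q : nonzero).

(* P_{>=0}: the points having nonnegative homogeneous coordinates. *)
Definition proj_ge0 : set proj_space :=
  [set q | exists2 v : nonzero, q = line_of v & forall i, 0 <= set_val v i].

(* The open face, with vertex set B, of the closed simplex P_{>=0}. *)
Definition simplex_open_face (B : {set I}) : set proj_space :=
  [set q | exists2 v : nonzero, q = line_of v &
     forall i, (i \in B -> 0 < set_val v i) /\ (i \notin B -> set_val v i = 0)].

End Projective.

Section Jewel.
Context {R : realType} {m : nat} (G : graph m).
Variables (c : nat -> R) (g : nat -> R -> R).
Local Notation Delta := 'I_m.+1.

Definition vol (S : {set Delta}) (x : {ptws Delta -> R}) : R :=
  \sum_(i in S) x i.

Definition jewel : set {ptws Delta -> R} :=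
  [set x | [/\ forall i, 0 <= x i,
               vol [set: Delta]%SET x = 1 &
               forall A : coreset G, c (h1rank G (val A)) <= vol (val A) x]].

Definition edges_of (A : coreset G) : finType := {i : Delta | i \in val A}.

Definition pi_map (A : coreset G) (x : {ptws Delta -> R}) :
    {ptws (edges_of A) -> R} :=
  fun i => x (val i) *
    \prod_(S : coreset G | (val i \in val S) && ~~ (val A \subset val S))
      g (h1rank G (val S)) (vol (val S) x).

Lemma ones_nonzero (A : coreset G) :
  (fun=> 1 : R) \in @nonzero R (edges_of A).
Proof.
have /andP[_ /set0Pn[i iA]] := valP A.
by apply/mem_set; exists (exist _ i iA); exact: oner_neq0.
Qed.

Definition ones (A : coreset G) : @nonzero R (edges_of A) :=
  Sub (fun=> 1) (ones_nonzero A).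

(* The point of P^A with homogeneous coordinates pi_A(x).  If pi_A(x) = 0,
   which does not happen for x in the jewel, the value is irrelevant; we use
   the point (1 : ... : 1). *)
Definition p_map (A : coreset G) (x : {ptws Delta -> R}) :
    proj_space R (edges_of A) :=
  line_of (insubd (ones A) (@pi_map A x)).

Definition proj_prod : topologicalType :=
  prod_topology (fun A : coreset G => proj_space R (edges_of A)).

Definition p_core (x : {ptws Delta -> R}) : proj_prod := fun A => p_map A x.

Definition proj_prod_ge0 : set proj_prod :=
  [set q | forall A, proj_ge0 (q A)].

(* The open faces of a product of closed simplices are the products of their
   open faces. *)
Definition proj_prod_open_faces : set (set proj_prod) :=
  [set W | exists2 B : forall A : coreset G, {set edges_of A},
     (forall A, B A != finset.set0) &
     W = [set q | forall A, simplex_open_face (B A) (q A)]].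

(* The affine chart "sum of the coordinates = 1" of each P^A.  Its domain
   contains all of P^A_{>=0}, which it identifies with the standard simplex in
   R^A; the smooth structure of the strata is read in this chart.  The target is
   the product of the R^A. *)
Definition bary (q : proj_prod) :
    {ptws {A : coreset G & edges_of A} -> R} :=
  fun s => hcoord (q (tag s)) (tagged s) / \sum_j hcoord (q (tag s)) j.

Definition p_core_diffeo_on (E : set {ptws Delta -> R}) : Prop :=
  diffeo E (bary @` (p_core @` E)) (bary \o p_core).

End Jewel.

Arguments jewel {R m} G c.
Arguments pi_map {R m} G g A.
Arguments p_map {R m} G g A.
Arguments p_core {R m} G g.
Arguments proj_prod R {m} G.
Arguments proj_prod_ge0 R {m} G.
Arguments proj_prod_open_faces R {m} G.
Arguments p_core_diffeo_on {R m} G g E.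

(* Main.v *)
Require Import Defs.
From HB Require Import structures.
From mathcomp Require Import all_boot all_order all_algebra.
From mathcomp Require Import generic_quotient.
From mathcomp Require Import all_classical all_reals all_analysis.
From mathcomp Require Import ring lra zify.

Set Implicit Arguments.
Unset Strict Implicit.
Unset Printing Implicit Defensive.

Import Order.TTheory GRing.Theory Num.Theory.
Import numFieldNormedType.Exports.

Local Open Scope ring_scope.
Local Open Scope classical_set_scope.

(* Take eps = 1.  The inequalities 2 c_r < c_(r+1) force the core subsets A with
   x_A = c_A to form a chain; hence the open faces of the jewel are the sets of
   points with prescribed vanishing coordinates and prescribed chain, and both are
   read off from the supports of the pi_A(x).

   Let cl(i) be the smallest member of the chain (Delta included) containing i.
   On the stratum of x the coordinates pi_(cl i)(x)_i with x_i != 0 are positive,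
   with logarithm
     L_i(x) = ln x_i + sum_(S contains i but not cl(i)) ln g_S(x_S),
   and p(x) determines L(x) up to one additive constant for each class of cl.
   If u is a difference of two points of the stratum (or a tangent vector), its
   sum over each class is zero, whence
     sum_(i in S, cl(i) not inside S) u_i = u_S   for every core S.
   Therefore the pairing of u with the increment of L is
     sum_i u_i * (increment of ln x_i) + sum_S u_S * (increment of ln g_S(x_S)),
   a sum of nonnegative terms because the g_S are nondecreasing, and it vanishes
   when L only changes by class constants.  Applied to two points this gives the
   injectivity of p; applied to tangent vectors it shows that the Jacobian of p,
   completed by the coordinates that are constant on the stratum, is invertible,
   and the inverse function theorem gives the smoothness of the inverse. *)

(** * Core subgraphs *)

(** Since each g_S is constant beyond c_(r+1), the terms of the pairing that come from the g_S may
    all vanish. Strictness comes only from the terms in ln x_i, because ln is strictly increasing,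
    and these are what force u = 0. The identity for u_S holds because a class whose set cl lies
    inside S is contained in S as a whole and contributes zero.

    A stratum is not open in the ambient space, so the inverse function theorem is applied at a
    point x0 to a map of the whole ambient space into itself that agrees on the stratum with a
    function of p. Its inverse is valid only near x0. Compactness of the jewel and injectivity of p
    close the gap: a point of the jewel whose image is near p(x0) is itself near x0.

    The g_r are controlled only on [c_r, 1]; for differentiation they are replaced by smooth
    functions on the real line. Questions of separation and smoothness in the product of projective
    spaces are moved by the barycentric charts to a finite power of the real line. *)

Section GraphFacts.
Context {m : nat} (G : graph m).
Implicit Types (A B : {set 'I_m.+1}) (i : 'I_m.+1).

Lemma adj_sym A : symmetric (adj (G := G) A).
Proof.
move=> u v; apply/existsP/existsP => -[i /andP[iA /orP H]]; exists i; rewrite iA /=;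
  by apply/orP; case: H => /andP[-> ->]; [right|left].
Qed.

Lemma connect_adj_sym A : connect_sym (adj (G := G) A).
Proof. exact/sym_connect_sym/adj_sym. Qed.

Lemma adj_sub A B : A \subset B -> subrel (adj (G := G) A) (adj B).
Proof.
move=> AB u v /existsP[i /andP[iA H]]; apply/existsP; exists i.
by rewrite (fintype.subsetP AB).
Qed.

Lemma connect_adj_sub A B : A \subset B ->
  subrel (connect (adj (G := G) A)) (connect (adj B)).
Proof.
move=> AB; apply: connect_sub => u v uv.
by apply: connect1; exact: adj_sub uv.
Qed.

Lemma adj_edge A i : i \in A -> adj A (src G i) (tgt G i).
Proof. by move=> iA; apply/existsP; exists i; rewrite iA !eqxx. Qed.

(** Sending each component of [A :\ i] to the component of [A] that contains it is a surjection. The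
    inequality makes it injective, and the two ends of [i] lie over the same component of [A]. *)
Lemma ncomp_bridge (W : {set vertex G}) A i : i \in A ->
  closed_mem (adj A) (mem W) -> src G i \in W ->
  (ncomp W (A :\ i) <= ncomp W A)%N = connect (adj (A :\ i)) (src G i) (tgt G i).
Proof.
move=> iA clW siW; set e' := adj (G := G) (A :\ i); set e := adj (G := G) A.
have e'e : subrel (connect e') (connect e).
  by apply: connect_adj_sub; exact: finset.subsetDl.
have [se' se] := (connect_adj_sym (A :\ i), connect_adj_sym A).
apply/idP/idP => [le|st].
  pose f (x : vertex G) := fingraph.root e x.
  have rW x y : connect e x y -> (x \in W) = (y \in W) by exact: closed_connect.
  have /image_injP f_inj : #|image_mem f (mem [predI fingraph.roots e' & W])| == #|[predI fingraph.roots e' & W]|.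
    rewrite eqn_leq leq_image_card/= (leq_trans le)//.
    apply/subset_leq_card/fintype.subsetP => r; rewrite !inE => /andP[rr rW'].
    apply/fintype.imageP; exists (fingraph.root e' r).
      rewrite !inE fingraph.roots_root//= -(rW r)//.
      exact/e'e/fingraph.connect_root.
    rewrite /f -{1}(eqP rr); apply/eqP; rewrite fingraph.root_connect//.
    exact/e'e/fingraph.connect_root.
  have siti : connect e (src G i) (tgt G i) by exact/connect1/adj_edge.
  rewrite -(fingraph.root_connect se'); apply/eqP; apply: f_inj.
  - by rewrite !inE fingraph.roots_root//= -(rW (src G i))//; exact/e'e/fingraph.connect_root.
  - rewrite !inE fingraph.roots_root//= -(rW (tgt G i)) -?(rW _ _ siti)//.
    exact/e'e/fingraph.connect_root.
  - apply/eqP; rewrite fingraph.root_connect//.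
    apply: connect_trans (connect_trans siti (e'e _ _ (fingraph.connect_root _ _))).
    by rewrite se; exact/e'e/fingraph.connect_root.
rewrite /ncomp leq_eqVlt; apply/orP; left; apply/eqP.
apply: eq_n_comp => x y; apply/idP/idP; first exact: e'e.
apply: connect_sub => u v /existsP[j /andP[jA H]].
have [ji|ji] := eqVneq j i; last first.
  by apply: connect1; apply/existsP; exists j; rewrite !inE ji jA.
move: H; rewrite ji => /orP[|] /andP[/eqP-> /eqP->] //.
by rewrite se'.
Qed.

Lemma verts_closed A : closed_mem (adj A) (mem (verts G A)).
Proof.
move=> u v /existsP[i /andP[iA H]].
have -> : u \in verts G A.
  rewrite inE; apply/existsP; exists i; rewrite iA /=.
  by case/orP: H => /andP[-> _]; rewrite ?orbT.
rewrite inE; symmetry; apply/existsP; exists i; rewrite iA /=.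
by case/orP: H => /andP[_ ->]; rewrite ?orbT.
Qed.

Lemma src_verts A i : i \in A -> src G i \in verts G A.
Proof. by move=> iA; rewrite inE; apply/existsP; exists i; rewrite iA eqxx. Qed.

(** Core means bridgeless. Unlike a count of components, the condition on a single edge visibly
    persists when [A] grows, whence [coreU]. *)
Lemma coreP A : reflect
  (forall i, i \in A -> connect (adj (A :\ i)) (src G i) (tgt G i)) (core G A).
Proof.
apply: (iffP forallP) => H i.
  move=> iA; have := H i; rewrite iA ncomp_bridge//.
    exact: verts_closed.
  exact: src_verts.
apply/implyP => iA; rewrite ncomp_bridge//; first exact: H.
  exact: verts_closed.
exact: src_verts.
Qed.

Lemma coreU A B : core G A -> core G B -> core G (A :|: B).
Proof.
move=> /coreP cA /coreP cB; apply/coreP => i; rewrite inE => /orP[/cA|/cB];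
  apply: connect_adj_sub; apply: finset.setSD.
  exact: finset.subsetUl.
exact: finset.subsetUr.
Qed.

Lemma core_setT : (forall i, ~~ separating G i) -> core G [set: 'I_m.+1]%SET.
Proof.
move=> sep; apply/coreP => i _; have := sep i.
rewrite /separating -leqNgt ncomp_bridge ?inE//.
by move=> u v _; rewrite !inE.
Qed.

Definition edge_rows : 'M[rat]_(m.+1, #|vertex G|) :=
  \matrix_(i, l) ((enum_val l == tgt G i)%:R - (enum_val l == src G i)%:R).

(** The row space of [boundary A], written without the enumeration of [A], so that inclusions of
    sets of edges become inclusions of subspaces. *)
Definition span A := (\sum_(i in A) <<row i edge_rows>>)%MS.

Lemma boundary_span A : (boundary G A :=: span A)%MS.
Proof.
apply/eqmxP/andP; split.
  apply/row_subP => k; apply: submx_trans (sumsmx_sup (enum_val k) _ (submx_refl _)).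
    rewrite genmxE; have -> : row k (boundary G A) = row (enum_val k) edge_rows.
      by apply/rowP => l; rewrite !mxE.
    exact: submx_refl.
  exact: enum_valP.
apply/sumsmx_subP => i iA; rewrite genmxE.
have -> : row i edge_rows = row (enum_rank_in iA i) (boundary G A).
  by apply/rowP => l; rewrite !mxE enum_rankK_in.
exact: row_sub.
Qed.

Lemma h1rankE A : h1rank G A = (#|A| - \rank (span A))%N.
Proof. by rewrite /h1rank mxrank_ker (boundary_span A). Qed.

Lemma rank_span_le A : (\rank (span A) <= #|A|)%N.
Proof. by rewrite -(boundary_span A) rank_leq_row. Qed.

(** Each edge of [B] outside [A] raises the rank of the boundary map by at most one, so the number
    of edges minus that rank cannot drop. *)
Lemma h1rank_mono A B : A \subset B -> (h1rank G A <= h1rank G B)%N.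
Proof.
move=> AB; rewrite !h1rankE.
have -> : #|B| = (#|A| + #|B :\: A|)%N by rewrite -(cardsID A B) (finset.setIidPr AB).
have : (\rank (span B) <= \rank (span A) + #|B :\: A|)%N.
  apply: leq_trans (leq_add (leqnn _) (rank_span_le (B :\: A))).
  apply: leq_trans (mxrank_adds_leqif _ _).1.
  apply/mxrankS/sumsmx_subP => i iB.
  have [iA|iA] := boolP (i \in A).
    by apply: submx_trans (addsmxSl _ _); exact: (sumsmx_sup i).
  by apply: submx_trans (addsmxSr _ _); apply: (sumsmx_sup i) => //; rewrite inE iA.
have := rank_span_le A; lia.
Qed.

(** Along a path joining the ends of [i], the rows of the edges add up, with signs, to the row of
    [i]. Deleting [i] thus keeps the row space and loses one edge, hence one dimension of the
    kernel. *)
Lemma h1rank_bridge A i : i \in A -> connect (adj (A :\ i)) (src G i) (tgt G i) ->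
  (h1rank G (A :\ i) < h1rank G A)%N.
Proof.
move=> iA con.
pose d (x : vertex G) : 'rV[rat]_#|vertex G| := \row_l (enum_val l == x)%:R.
have dE j : row j edge_rows = d (tgt G j) - d (src G j).
  by apply/rowP => l; rewrite !mxE.
have sub_i : (row i edge_rows <= span (A :\ i))%MS.
  rewrite dE; case/connectP: con => p.
  elim: p (src G i) => [|y p IH] x /=; first by move=> _ ->; rewrite subrr sub0mx.
  move=> /andP[xy yp] E; have -> : d (tgt G i) - d x = (d (tgt G i) - d y) + (d y - d x).
    by rewrite addrA subrK.
  apply: addmx_sub; first exact: IH yp E.
  case/existsP: xy => j /andP[jA H].
  have rj : (row j edge_rows <= span (A :\ i))%MS.
    by apply: (sumsmx_sup j) => //; rewrite genmxE.
  case/orP: H => /andP[/eqP-> /eqP->]; first by rewrite -dE.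
  by rewrite -opprB -dE eqmx_opp.
have : (\rank (span A) <= \rank (span (A :\ i)))%N.
  apply/mxrankS/sumsmx_subP => j jA; have [->|ji] := eqVneq j i.
    by rewrite genmxE.
  by apply: (sumsmx_sup j) => //; rewrite !inE ji.
rewrite !h1rankE (cardsD1 i A) iA add1n.
by move=> H; rewrite subSn ?ltnS ?leq_sub2l// (leq_trans H)// rank_span_le.
Qed.

(** An edge of [B] outside [A] is not a bridge of [B]. Deleting it already lowers the rank, and what
    remains still contains [A]. *)
Lemma core_h1rank_lt A B : A \proper B -> core G B -> (h1rank G A < h1rank G B)%N.
Proof.
move=> /properP[AB [i iB iA]] /coreP cB.
apply: leq_ltn_trans (h1rank_bridge iB (cB i iB)).
by apply: h1rank_mono; rewrite subsetD1 AB.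
Qed.

Lemma core_h1rank_gt0 A : core G A -> A != finset.set0 -> (0 < h1rank G A)%N.
Proof.
move=> cA A0; apply: leq_ltn_trans (core_h1rank_lt (A := finset.set0) _ cA) => //.
by rewrite finset.proper0.
Qed.

End GraphFacts.

(** * Differentiability classes on finite powers of the real line *)

Section Calculus.
Context {R : realType}.

Definition upd (I : finType) (x : {ptws I -> R}) (i : I) (t : R) : {ptws I -> R} :=
  fun j => if j == i then t else x j.

Definition l1 (I : finType) (x : I -> R) : R := \sum_i `|x i|.

Definition sub (I : finType) (x y : {ptws I -> R}) : {ptws I -> R} :=
  fun i => x i - y i.

Lemma le_l1 (I : finType) (x : I -> R) i : `|x i| <= l1 x.
Proof. by rewrite /l1 (bigD1 i)//= lerDl sumr_ge0. Qed.

Lemma l1_ge0 (I : finType) (x : I -> R) : 0 <= l1 x.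
Proof. by rewrite /l1 sumr_ge0. Qed.

Lemma nbhs_ptwsP (I : finType) (x : {ptws I -> R}) (A : set {ptws I -> R}) :
  nbhs x A <-> exists2 e : R, 0 < e &
    forall y : {ptws I -> R}, (forall i, `|y i - x i| < e) -> A y.
Proof.
split=> [|[e e0 H]]; last first.
  have : \forall y \near x, forall i, `|y i - x i| < e.
    apply: (@filter_forall _ _ (fun i (y : {ptws I -> R}) => `|y i - x i| < e) _ (nbhs_filter x)) => i.
    have : {for x, continuous (fun y : {ptws I -> R} => y i : R^o)}.
      exact: (@proj_continuous I (fun=> R) i x).
    move=> /cvgrPdist_lt/(_ e e0).
    by apply: filterS => y; rewrite distrC.
  exact: (@filterS _ (nbhs x) (nbhs_filter x) _ _ H).
(* Convergence to [x] of the filter of sup-norm balls says that every neighbourhood of [x] contains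
   such a ball, and it can be tested coordinate by coordinate. *)
pose F : set_system {ptws I -> R} := [set B : set {ptws I -> R} | exists2 e : R, 0 < e &
    forall y : {ptws I -> R}, (forall i, `|y i - x i| < e) -> B y].
have FF : Filter F.
  split.
  - by exists 1.
  - move=> P Q [e e0 eP] [d d0 dQ]; exists (Num.min e d).
      by rewrite lt_min e0.
    move=> y yx; split; [apply: eP|apply: dQ] => i.
      by have := yx i; rewrite lt_min => /andP[].
    by have := yx i; rewrite lt_min => /andP[].
  - by move=> P Q PQ [e e0 eP]; exists e => // y /eP /PQ.
suff FA : F --> x by exact: FA.
apply/cvg_sup => i; apply/cvg_image => //.
  rewrite eqEsubset; split => // t _; exists (fun=> t) => //.
move=> B /nbhs_ballP[e/= e0 eB].
exists ((fun f : {ptws I -> R} => f i) @^-1` B).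
  exists e => // y /(_ i) yx /=; apply: eB.
  by rewrite /ball/= distrC.
rewrite eqEsubset; split => [t [y /= By <-]//|t Bt].
by exists (fun=> t).
Qed.

Lemma continuous_ptwsP (I : finType) (f : {ptws I -> R} -> R) (x : {ptws I -> R}) :
  {for x, continuous f} <-> forall e, 0 < e -> exists2 d : R, 0 < d &
    forall y : {ptws I -> R}, (forall i, `|y i - x i| < d) -> `|f y - f x| < e.
Proof.
split=> [/cvgrPdist_lt fx e e0|H].
  have /nbhs_ptwsP[d d0 dP] := fx e e0.
  by exists d => // y /dP; rewrite distrC.
move=> B /nbhs_ballP[e/= e0 eB].
suff : nbhs x (f @^-1` B) by [].
apply/nbhs_ptwsP; have [d d0 dP] := H e e0; exists d => // y /dP yd.
by apply: eB; rewrite /ball/= distrC.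
Qed.

Lemma open_ptwsP (I : finType) (U : set {ptws I -> R}) : open U ->
  forall x, U x -> exists2 e : R, 0 < e &
    forall y : {ptws I -> R}, (forall i, `|y i - x i| < e) -> U y.
Proof. by move=> oU x Ux; apply/nbhs_ptwsP/open_nbhs_nbhs. Qed.

Lemma MVT_ball (g : R -> R) (w d a b : R) :
  `|a - w| < d -> `|b - w| < d -> (forall t, `|t - w| < d -> derivable g t 1) ->
  exists2 c, `|c - w| < d & g b - g a = derive1 g c * (b - a).
Proof.
wlog ab : a b / a <= b.
  move=> W ad bd gd; have [ab|/ltW ba] := leP a b; first exact: W.
  have [c cd E] := W _ _ ba bd ad gd; exists c => //.
  by rewrite -opprB E -mulrN opprB.
move=> ad bd gd.
have H t : t \in `[a, b]%R -> `|t - w| < d.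
  rewrite in_itv/= => /andP[at_ tb]; move: ad bd; rewrite !ltr_norml.
  by move=> /andP[? ?] /andP[? ?]; apply/andP; split; lra.
have [||c cab E] := @MVT_segment _ g (derive1 g) a b ab.
- move=> t tab; rewrite derive1E; apply: derivableP; apply: gd; apply: H.
  exact: subset_itv_oo_cc tab.
- apply: derivable_within_continuous => t tab.
  exact/gd/H.
by exists c => //; exact: H.
Qed.

Lemma updE (I : finType) (x : {ptws I -> R}) i t : upd x i t i = t.
Proof. by rewrite /upd eqxx. Qed.

Lemma upd_upd (I : finType) (x : {ptws I -> R}) i s t :
  upd (upd x i s) i t = upd x i t.
Proof. by apply/funext => j; rewrite /upd; case: eqP. Qed.

Lemma upd_id (I : finType) (x : {ptws I -> R}) i : upd x i (x i) = x.
Proof. by apply/funext => j; rewrite /upd; case: eqP => [->|]. Qed.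

Lemma partialE (I : finType) (f : {ptws I -> R} -> R) i x :
  partial i f x = derive1 (fun t => f (upd x i t)) (x i).
Proof. by []. Qed.

(** From [x] to [y] one coordinate is changed at a time ([mix]), and the mean value theorem turns
    each step into a partial derivative at a point close to [x0]. The estimate is uniform in both
    [x] and [y]; this strict form is what the contraction in the inverse function theorem
    requires. *)
Lemma strict_diff (I : finType) (U : set {ptws I -> R}) (f : {ptws I -> R} -> R)
    (x0 : {ptws I -> R}) (e : R) :
  open U -> U x0 -> 0 < e ->
  (forall i, (forall x, U x -> derivable (fun t => f (upd x i t)) (x i) 1) /\
     {for x0, continuous (partial i f)}) ->
  exists2 d : R, 0 < d & forall x y : {ptws I -> R},
    (forall i, `|x i - x0 i| < d) -> (forall i, `|y i - x0 i| < d) ->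
    `|f y - f x - \sum_i partial i f x0 * (y i - x i)| <= e * l1 (sub y x).
Proof.
move=> oU Ux0 e0 fU.
have : \forall z \near x0, U z /\ forall i, `|partial i f z - partial i f x0| < e.
  apply: filterI; first exact: open_nbhs_nbhs.
  apply: (@filter_forall _ _ (fun i z => `|partial i f z - partial i f x0| < e) _
    (nbhs_filter x0)) => i; have [_ /cvgrPdist_lt/(_ e e0)] := fU i.
  by apply: filterS => z; rewrite distrC.
move=> /nbhs_ptwsP[d d0 dP]; exists d => // x y xd yd.
pose mix (s : seq I) : {ptws I -> R} := fun j => if j \in s then y j else x j.
have mixd s j : `|mix s j - x0 j| < d by rewrite /mix; case: ifP.
have key s : uniq s -> `|f (mix s) - f x - \sum_(i <- s) partial i f x0 * (y i - x i)|
     <= e * \sum_(i <- s) `|y i - x i|.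
  elim: s => [_|i s IH /= /andP[is_ us]].
    rewrite !big_nil mulr0 subr0.
    have -> : mix [::] = x by apply/funext.
    by rewrite subrr normr0.
  have mE : mix (i :: s) = upd (mix s) i (y i).
    by apply/funext => j; rewrite /mix /upd inE; case: eqP => [->|].
  have mE' : mix s = upd (mix s) i (x i).
    apply/funext => j; rewrite /mix /upd; case: eqP => [->|//].
    by rewrite (negbTE is_).
  have updd t : `|t - x0 i| < d -> forall j, `|upd (mix s) i t j - x0 j| < d.
    by move=> td j; rewrite /upd; case: eqP => [->//|_].
  have [||t td|c cd E] := @MVT_ball (fun t => f (upd (mix s) i t)) (x0 i) d (x i) (y i).
  - exact: xd.
  - exact: yd.
  - have [fi _] := fU i; have [Ut _] := dP _ (updd t td).
    have := fi _ Ut; rewrite updE.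
    by under eq_fun do rewrite upd_upd.
  have {}E : f (mix (i :: s)) - f (mix s) = partial i f (upd (mix s) i c) * (y i - x i).
    rewrite mE {2}mE' E partialE updE.
    by under [in RHS]eq_fun do rewrite upd_upd.
  rewrite !big_cons [leRHS]mulrDr.
  have -> : f (mix (i :: s)) - f x - (partial i f x0 * (y i - x i) +
     \sum_(j <- s) partial j f x0 * (y j - x j)) =
     (partial i f (upd (mix s) i c) - partial i f x0) * (y i - x i) +
     (f (mix s) - f x - \sum_(j <- s) partial j f x0 * (y j - x j)).
    by rewrite mulrBl -E; ring.
  rewrite (le_trans (ler_normD _ _))// lerD ?IH// normrM ler_wpM2r// ltW//.
  by have [_] := dP _ (updd c cd).
have := key (index_enum I) (index_enum_uniq I).
by have -> : mix (index_enum I) = y by apply/funext => j; rewrite /mix mem_index_enum.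
Qed.

End Calculus.

(** * First-order expansions and the chain rule along a curve *)

Section Derivative.
Context {R : realType}.

Lemma is_derive1P (f : R -> R) (x d : R) :
  is_derive x (1 : R) f d <-> forall e, 0 < e -> exists2 k : R, 0 < k &
    forall h, `|h| < k -> `|f (x + h) - f x - d * h| <= e * `|h|.
Proof.
pose q (h : R) := h^-1 *: ((f \o shift x) (h *: (1 : R)) - f x).
have qE e h : h != 0 -> (`|d - q h| <= e) = (`|f (x + h) - f x - d * h| <= e * `|h|).
  move=> h0; rewrite -(ler_pM2r (_ : 0 < `|h|)) ?normr_gt0// -normrM.
  rewrite [X in X <= _](_ : _ = `|f (x + h) - f x - d * h|)// -normrN; congr `|_|.
  rewrite /q /= [h *: 1]mulr1 [h^-1 *: _]mulrC (addrC h x).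
  by rewrite mulrBl -mulrA mulVf// mulr1 opprB.
split=> [[dq qd] e e0|H].
  have {}qd : q @ 0^' --> d by rewrite -qd; exact: dq.
  have /cvgrPdist_le/(_ e e0) := qd.
  rewrite near_withinE => /nbhs_ballP[k/= k0 kP]; exists k => // h hk.
  have [->|h0] := eqVneq h 0; first by rewrite addr0 subrr mulr0 subrr normr0 mulr0.
  by rewrite -qE//; apply: kP => //; rewrite /ball/= sub0r normrN.
have {}qd : q @ 0^' --> d.
  apply/cvgrPdist_le => e e0; have [k k0 kP] := H e e0.
  rewrite near_withinE; apply/nbhs_ballP; exists k => //= h.
  by rewrite /ball/= sub0r normrN => hk h0; rewrite qE//; exact: kP.
apply: DeriveDef; last exact: cvg_lim qd.
by apply/cvg_ex; exists d.
Qed.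

Lemma is_derive_curve (I : finType) (f : {ptws I -> R} -> R)
    (gam : R -> {ptws I -> R}) (t : R) (D : I -> R) (p : I -> R) :
  (forall e : R, 0 < e -> exists2 k : R, 0 < k & forall x : {ptws I -> R},
     (forall i, `|x i - gam t i| < k) ->
     `|f x - f (gam t) - \sum_i p i * (x i - gam t i)| <= e * l1 (sub x (gam t))) ->
  (forall i, is_derive t (1 : R) (fun s => gam s i) (D i)) ->
  is_derive t (1 : R) (fun s => f (gam s)) (\sum_i p i * D i).
Proof.
move=> fd gd; apply/is_derive1P => e e0.
(* [a] times [|h|] bounds the l1 norm of the increment of [gam], and [b] exceeds the l1 norm of [p].
   The error of [f] and the errors of the coordinates of [gam] then cost at most half of [e] times
   [|h|] each. *)
set a : R := l1 D + #|I|%:R + 1; set b : R := l1 p + 1.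
have a0 : 0 < a by rewrite ltr_wpDl// addr_ge0// l1_ge0.
have b0 : 0 < b by rewrite ltr_wpDl// l1_ge0.
have [k k0 kP] := fd (e / 2 / a) (divr_gt0 (divr_gt0 e0 (ltr0Sn _ _)) a0).
set e1 := Num.min 1 (e / 2 / b).
have e10 : 0 < e1 by rewrite lt_min ltr01 !divr_gt0.
have : \forall h \near 0, forall i,
    `|gam (t + h) i - gam t i - D i * h| <= e1 * `|h|.
  apply: (@filter_forall _ _ (fun i (h : R) =>
    `|gam (t + h) i - gam t i - D i * h| <= e1 * `|h|) _ (nbhs_filter 0)) => i.
  have [d d0 dP] := (is_derive1P (fun s => gam s i) t (D i)).1 (gd i) e1 e10.
  by apply/nbhs_ballP; exists d => //= h; rewrite /ball/= sub0r normrN; exact: dP.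
move=> /nbhs_ballP[d/= d0 dP].
have inc h i : `|h| < d -> `|gam (t + h) i - gam t i| <= (`|D i| + 1) * `|h|.
  move=> hd; have hd' : ball (0 : R) d h by rewrite /ball/= sub0r normrN.
  have H := dP h hd' i.
  rewrite -(subrK (D i * h) (_ - _)) (le_trans (ler_normD _ _))// addrC mulrDl lerD//.
    by rewrite normrM.
  by rewrite (le_trans H)// ler_wpM2r// ge_min lexx.
exists (Num.min d (k / a)) => [|h]; first by rewrite lt_min d0 divr_gt0.
rewrite lt_min => /andP[hd hk].
have Da i : `|D i| + 1 <= a.
  rewrite /a lerD2r (le_trans (le_l1 D i))// lerDl//.
have /kP fk : forall i, `|gam (t + h) i - gam t i| < k.
  move=> i; rewrite (le_lt_trans (inc h i hd))//.
  by rewrite (le_lt_trans (ler_wpM2r _ (Da i)))// mulrC -ltr_pdivlMr.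
have l1h : l1 (sub (gam (t + h)) (gam t)) <= a * `|h|.
  rewrite /l1 (@le_trans _ _ (\sum_i (`|D i| + 1) * `|h|))//.
    by apply: ler_sum => i _; exact: inc.
  rewrite -mulr_suml ler_wpM2r// big_split/= sumr_const -/(l1 D).
  by rewrite lerDl.
have -> : f (gam (t + h)) - f (gam t) - (\sum_i p i * D i) * h =
   (f (gam (t + h)) - f (gam t) - \sum_i p i * (gam (t + h) i - gam t i)) +
   \sum_i p i * (gam (t + h) i - gam t i - D i * h).
  rewrite mulr_suml -[in LHS](subrK (\sum_i p i * (gam (t + h) i - gam t i)) (f (gam (t + h)) - f (gam t))).
  rewrite -[in LHS]addrA; congr (_ + _); rewrite -sumrB; apply: eq_bigr => i _.
  by ring.
rewrite (le_trans (ler_normD _ _))//.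
have -> : e * `|h| = e / 2 / a * (a * `|h|) + e / 2 * `|h|.
  by rewrite -[in RHS]mulrA mulKf ?gt_eqF//; field.
rewrite lerD//.
  by rewrite (le_trans fk)// ler_wpM2l// !divr_ge0// ltW.
rewrite (le_trans (ler_norm_sum _ _ _))//.
rewrite (@le_trans _ _ (\sum_i `|p i| * (e1 * `|h|)))//.
  apply: ler_sum => i _; rewrite normrM ler_wpM2l//.
  by apply: dP; rewrite /ball/= sub0r normrN.
rewrite -mulr_suml -/(l1 p) mulrA ler_wpM2r//.
rewrite (@le_trans _ _ (b * (e / 2 / b)))//; last by rewrite mulrC divfK// gt_eqF.
by rewrite ler_pM ?l1_ge0// ?(ltW e10)// ?lerDl// ge_min lexx orbT.
Qed.

End Derivative.

(** * Functions of class C^k and their rules of calculus *)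

Section DifferentiabilityClasses.
Context {R : realType}.

Definition pder (I : finType) (i : I) (f : {ptws I -> R} -> R) x (d : R) :=
  is_derive (x i) (1 : R) (fun t => f (upd x i t)) d.

Lemma pder_partial (I : finType) (i : I) (f : {ptws I -> R} -> R) x d :
  pder i f x d -> partial i f x = d.
Proof. by case=> _ <-; rewrite partialE derive1E. Qed.

(* Ck k.+1 does not ask for the continuity of f itself; DC does, so that each
   class contains the next one. *)
Fixpoint DC (I : finType) (k : nat) (U : set {ptws I -> R})
    (f : {ptws I -> R} -> R) : Prop :=
  (forall x, U x -> {for x, continuous f}) /\
  match k with
  | 0%N => True
  | k'.+1 => forall i : I,
      (forall x, U x -> pder i f x (partial i f x)) /\ DC k' U (partial i f)
  end.

Lemma DC_cont (I : finType) k U (f : {ptws I -> R} -> R) :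
  DC k U f -> forall x, U x -> {for x, continuous f}.
Proof. by case: k => [|k] []. Qed.

Lemma DC_pred (I : finType) k U (f : {ptws I -> R} -> R) :
  DC k.+1 U f -> DC k U f.
Proof.
elim: k f => [f []//|k IH f [cf H]]; split=> // i.
by have [df Hi] := H i; split => //; exact: IH.
Qed.

Lemma DC_Ck (I : finType) k U (f : {ptws I -> R} -> R) : DC k U f -> Ck k U f.
Proof.
elim: k f => [f []//|k IH f [cf H]] i; have [df Hi] := H i; split; last exact: IH.
by move=> x /df[].
Qed.

Lemma near_upd (I : finType) (U : set {ptws I -> R}) (x : {ptws I -> R}) i :
  open U -> U x -> \forall t \near x i, U (upd x i t).
Proof.
move=> oU Ux; have [e e0 eP] := open_ptwsP oU Ux.
apply/nbhs_ballP; exists e => //= t; rewrite /ball/= distrC => xt.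
by apply: eP => j; rewrite /upd; case: eqP => [->//|]; rewrite subrr normr0.
Qed.

Lemma pder_ext (I : finType) i U (f g : {ptws I -> R} -> R) x d : open U ->
  (forall y, U y -> f y = g y) -> U x -> pder i f x d -> pder i g x d.
Proof.
move=> oU fg Ux; apply: near_eq_is_derive.
by have := near_upd i oU Ux; apply: filterS => t; exact: fg.
Qed.

Lemma cont_ext (I : finType) U (f g : {ptws I -> R} -> R) x : open U ->
  (forall y, U y -> f y = g y) -> U x ->
  {for x, continuous f} -> {for x, continuous g}.
Proof.
move=> oU fg Ux /continuous_ptwsP fx; apply/continuous_ptwsP => e e0.
have [d d0 dP] := fx e e0; have [a a0 aP] := open_ptwsP oU Ux.
exists (Num.min a d) => [|y yx]; first by rewrite lt_min a0.
rewrite -!fg//; last first.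
  by apply: aP => i; have := yx i; rewrite lt_min => /andP[].
by apply: dP => i; have := yx i; rewrite lt_min => /andP[].
Qed.

Lemma DC_ext (I : finType) k U (f g : {ptws I -> R} -> R) : open U ->
  (forall x, U x -> f x = g x) -> DC k U f -> DC k U g.
Proof.
move=> oU; elim: k f g => [|k IH] f g fg [cf H].
  by split=> // x Ux; apply: (cont_ext oU fg) => //; exact: cf.
split=> [x Ux|i]; first by apply: (cont_ext oU fg) => //; exact: cf.
have [df Hi] := H i.
have E x : U x -> partial i f x = partial i g x.
  by move=> Ux; apply/esym/pder_partial/(pder_ext oU fg) => //; exact: df.
split=> [x Ux|]; last exact: (IH (partial i f)).
by rewrite -E//; apply: (pder_ext oU fg) => //; exact: df.
Qed.

Lemma DC_sub (I : finType) k (U V : set {ptws I -> R}) (f : {ptws I -> R} -> R) :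
  V `<=` U -> DC k U f -> DC k V f.
Proof.
move=> VU; elim: k f => [f [cf _]|k IH f [cf H]]; first by split=> // x /VU/cf.
split=> [x /VU/cf//|i]; have [df Hi] := H i; split; last exact: IH.
by move=> x /VU/df.
Qed.

Lemma DC_step (I : finType) k U (f : {ptws I -> R} -> R)
    (g : I -> {ptws I -> R} -> R) : open U ->
  (forall x, U x -> {for x, continuous f}) ->
  (forall i x, U x -> pder i f x (g i x)) -> (forall i, DC k U (g i)) ->
  DC k.+1 U f.
Proof.
move=> oU cf df dg; split=> // i.
have E x : U x -> g i x = partial i f x by move=> /(df i)/pder_partial.
split=> [x Ux|]; last exact: DC_ext (dg i).
by rewrite -E//; exact: df.
Qed.

Lemma DC_cst (I : finType) k U (c : R) : open U -> DC k U (fun _ : {ptws I -> R} => c).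
Proof.
move=> oU; elim: k c => [|k IH] c; first by split=> // x _; exact: cst_continuous.
apply: (@DC_step _ _ _ _ (fun _ _ => 0)) => //.
  by move=> x _; exact: cst_continuous.
by move=> i x _; exact: is_derive_cst.
Qed.

Lemma cont_coord (I : finType) (j : I) (x : {ptws I -> R}) :
  {for x, continuous (fun y : {ptws I -> R} => y j)}.
Proof. exact: (@proj_continuous I (fun=> R) j x). Qed.

Lemma DC_coord (I : finType) k U (j : I) : open U -> DC k U (fun x : {ptws I -> R} => x j).
Proof.
move=> oU; case: k => [|k]; first by split=> // x _; exact: cont_coord.
apply: (@DC_step _ _ _ _ (fun i _ => (j == i)%:R)) => //.
- by move=> x _; exact: cont_coord.
- by move=> i x _; rewrite /pder /upd; case: eqP => _; [exact: is_derive_id|exact: is_derive_cst].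
- by move=> i; exact: DC_cst.
Qed.

Lemma DC_add (I : finType) k U (f g : {ptws I -> R} -> R) : open U ->
  DC k U f -> DC k U g -> DC k U (fun x => f x + g x).
Proof.
move=> oU; elim: k f g => [|k IH] f g [cf Hf] [cg Hg].
  by split=> // x Ux; apply: (@continuousD R R^o); [exact: cf|exact: cg].
apply: (@DC_step _ _ _ _ (fun i x => partial i f x + partial i g x)) => //.
- by move=> x Ux; apply: (@continuousD R R^o); [exact: cf|exact: cg].
- move=> i x Ux; apply: is_deriveD; [exact: (Hf i).1|exact: (Hg i).1].
- by move=> i; apply: IH; [exact: (Hf i).2|exact: (Hg i).2].
Qed.

Lemma DC_mul (I : finType) k U (f g : {ptws I -> R} -> R) : open U ->
  DC k U f -> DC k U g -> DC k U (fun x => f x * g x).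
Proof.
move=> oU; elim: k f g => [|k IH] f g Hf Hg.
  by split=> // x Ux; apply: continuousM; [exact: Hf.1|exact: Hg.1].
have [Hf' Hg'] := (DC_pred Hf, DC_pred Hg).
case: Hf => cf Hf; case: Hg => cg Hg.
apply: (@DC_step _ _ _ _ (fun i x => f x * partial i g x + g x * partial i f x)) => //.
- by move=> x Ux; apply: continuousM; [exact: cf|exact: cg].
- move=> i x Ux; have [dfx dfE] := (Hf i).1 x Ux; have [dgx dgE] := (Hg i).1 x Ux.
  apply: DeriveDef; first exact: derivableM.
  by rewrite (deriveM dfx dgx) dfE dgE !upd_id.
- by move=> i; apply: DC_add => //; apply: IH => //; [exact: (Hg i).2|exact: (Hf i).2].
Qed.

Lemma DC_inv (I : finType) k U (f : {ptws I -> R} -> R) : open U ->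
  (forall x, U x -> f x != 0) -> DC k U f -> DC k U (fun x => (f x)^-1).
Proof.
move=> oU f0; elim: k => [|k IH] Hf.
  by split=> // x Ux; apply: continuousV; [exact: f0|exact: Hf.1].
have Hf' := IH (DC_pred Hf); case: Hf => cf Hf.
apply: (@DC_step _ _ _ _ (fun i x => - 1 * ((f x)^-1 * (f x)^-1) * partial i f x)) => //.
- by move=> x Ux; apply: continuousV; [exact: f0|exact: cf].
- move=> i x Ux; have [dfx dfE] := (Hf i).1 x Ux.
  have fx0 : f (upd x i (x i)) != 0 by rewrite upd_id; exact: f0.
  apply: DeriveDef; first exact: derivableV.
  rewrite (deriveV fx0 dfx) dfE upd_id.
  by rewrite -[_ *: _]/(_ * _) mulN1r -expr2 exprVn.
- move=> i; apply: DC_mul => //; last exact: (Hf i).2.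
  by apply: DC_mul; [|exact: DC_cst|exact: DC_mul].
Qed.

Lemma open_neq0_in (I : finType) (U : set {ptws I -> R}) (f : {ptws I -> R} -> R) :
  open U -> DC 0 U f -> open [set x | U x /\ f x != 0].
Proof.
move=> oU cf; rewrite openE => x [Ux fx]; apply: filterI; first exact: open_nbhs_nbhs.
have N : nbhs (f x) [set t : R | t != 0].
  by apply: open_nbhs_nbhs; split => //; exact: open_neq.
exact: (DC_cont cf Ux) N.
Qed.

Lemma open_neq0 (I : finType) (f : {ptws I -> R} -> R) :
  DC 0 setT f -> open [set x | f x != 0].
Proof.
move=> cf; rewrite (_ : [set x | f x != 0] = [set x | setT x /\ f x != 0]).
  by apply: open_neq0_in cf; exact: openT.
by apply/seteqP; split=> x //= [].
Qed.

Lemma DC_sum (I : finType) (J : Type) (s : seq J) (P : pred J) k U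
    (f : J -> {ptws I -> R} -> R) : open U ->
  (forall j, P j -> DC k U (f j)) -> DC k U (fun x => \sum_(j <- s | P j) f j x).
Proof.
move=> oU fU; elim: s => [|j s IH].
  by apply: DC_ext (DC_cst k 0 oU) => // x _; rewrite big_nil.
have [Pj|nPj] := boolP (P j).
  apply: DC_ext (DC_add oU (fU j Pj) IH) => // x _; by rewrite big_cons Pj.
by apply: DC_ext IH => // x _; rewrite big_cons (negbTE nPj).
Qed.

Lemma DC_prod (I : finType) (J : Type) (s : seq J) (P : pred J) k U
    (f : J -> {ptws I -> R} -> R) : open U ->
  (forall j, P j -> DC k U (f j)) -> DC k U (fun x => \prod_(j <- s | P j) f j x).
Proof.
move=> oU fU; elim: s => [|j s IH].
  by apply: DC_ext (DC_cst k 1 oU) => // x _; rewrite big_nil.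
have [Pj|nPj] := boolP (P j).
  apply: DC_ext (DC_mul oU (fU j Pj) IH) => // x _; by rewrite big_cons Pj.
by apply: DC_ext IH => // x _; rewrite big_cons (negbTE nPj).
Qed.

Lemma DC_strict (I : finType) k U (f : {ptws I -> R} -> R) (x0 : {ptws I -> R})
    (e : R) : open U -> DC k.+1 U f -> U x0 -> 0 < e ->
  exists2 d : R, 0 < d & forall x y : {ptws I -> R},
    (forall i, `|x i - x0 i| < d) -> (forall i, `|y i - x0 i| < d) ->
    `|f y - f x - \sum_i partial i f x0 * (y i - x i)| <= e * l1 (sub y x).
Proof.
move=> oU [cf Hf] Ux0 e0; apply: (strict_diff oU) => // i.
have [df Hi] := Hf i; split=> [x /df[]//|]; exact: (DC_cont Hi).
Qed.

Lemma DC_curve (I : finType) k U (f : {ptws I -> R} -> R)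
    (gam : R -> {ptws I -> R}) (t : R) (D : I -> R) :
  open U -> DC k.+1 U f -> U (gam t) ->
  (forall i, is_derive t (1 : R) (fun s => gam s i) (D i)) ->
  is_derive t (1 : R) (fun s => f (gam s)) (\sum_i partial i f (gam t) * D i).
Proof.
move=> oU fU Ut gd; apply: is_derive_curve => // e e0.
have [d d0 dP] := DC_strict oU fU Ut e0.
by exists d => // x xd; apply: dP => // i; rewrite subrr normr0.
Qed.

Lemma DC_comp (I J : finType) k (U : set {ptws I -> R}) (V : set {ptws J -> R})
    (f : {ptws I -> R} -> R) (h : {ptws J -> R} -> {ptws I -> R}) :
  open U -> open V -> DC k U f -> (forall i, DC k V (fun y => h y i)) ->
  (forall y, V y -> U (h y)) -> DC k V (fun y => f (h y)).
Proof.
move=> oU oV + + hUV.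
have C g : (forall x, U x -> {for x, continuous g}) ->
    (forall i y, V y -> {for y, continuous (fun y => h y i)}) ->
    forall y : {ptws J -> R}, V y -> {for y, continuous (fun y => g (h y) : R)}.
  move=> cg ch y Vy; apply/continuous_ptwsP => e e0.
  have /continuous_ptwsP/(_ e e0)[d d0 dP] := cg _ (hUV y Vy).
  have : \forall z \near y, forall i, `|h z i - h y i| < d.
    apply: (@filter_forall _ _ (fun i z => `|h z i - h y i| < d) _
      (nbhs_filter y)) => i.
    have /cvgrPdist_lt/(_ d d0) := ch i y Vy.
    by apply: filterS => z; rewrite distrC.
  move=> /nbhs_ptwsP[a a0 aP]; exists a => // z /aP zd; exact: dP.
elim: k f => [|k IH] f Hf Hh.
  by split=> //; apply: C; [exact: Hf.1|move=> i; exact: (Hh i).1].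
have Hh' i := DC_pred (Hh i).
apply: (@DC_step _ _ _ _
  (fun j y => \sum_i partial i f (h y) * partial j (fun y => h y i) y)) => //.
- by apply: C; [exact: Hf.1|move=> i; exact: (Hh i).1].
- move=> j y Vy.
  have Uy : U (h (upd y j (y j))) by rewrite upd_id; exact: hUV.
  have := DC_curve oU Hf Uy (fun i => ((Hh i).2 j).1 y Vy).
  by rewrite upd_id.
- move=> j; apply: DC_sum => // i _; apply: DC_mul => //.
    by apply: IH => //; exact: (Hf.2 i).2.
  exact: ((Hh i).2 j).2.
Qed.

End DifferentiabilityClasses.

(** * The inverse function theorem *)

Section InverseFunction.
Context {R : realType}.

Lemma DC_det (I : finType) n k U (A : {ptws I -> R} -> 'M[R]_n) : open U ->
  (forall i j, DC k U (fun x => A x i j)) -> DC k U (fun x => \det (A x)).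
Proof.
move=> oU AU; apply: DC_sum => // s _; apply: DC_mul => //; first exact: DC_cst.
by apply: DC_prod => // i _.
Qed.

(** By Cramer's rule the entries of the inverse are cofactors divided by the determinant. *)
Lemma DC_invmx (I : finType) n k U (A : {ptws I -> R} -> 'M[R]_n) : open U ->
  (forall x, U x -> \det (A x) != 0) ->
  (forall i j, DC k U (fun x => A x i j)) ->
  forall i j, DC k U (fun x => invmx (A x) i j).
Proof.
move=> oU A0 AU i j.
apply: (@DC_ext _ _ _ _ (fun x => (\det (A x))^-1 *
    ((-1) ^+ (j + i) * \det (row' j (col' i (A x)))))) => //.
  by move=> x Ux; rewrite /invmx unitmxE unitfE A0// !mxE.
apply: DC_mul => //; first by apply: DC_inv => //; exact: DC_det.
apply: DC_mul => //; first exact: DC_cst.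
apply: DC_det => // a b.
by apply: (@DC_ext _ _ _ _ (fun x => A x (lift j a) (lift i b))) => // x _; rewrite !mxE.
Qed.

Lemma common_radius (I : finType) (P : I -> R -> Prop) :
  (forall i a b, a <= b -> P i b -> P i a) ->
  (forall i, exists2 d : R, 0 < d & P i d) -> exists2 d : R, 0 < d & forall i, P i d.
Proof.
move=> mono H.
have /choice[d dP] i : exists d : R, 0 < d /\ P i d by have [d ? ?] := H i; exists d.
(* The initial value [1] supplies a positive radius when [I] is empty. *)
exists (\big[Order.min/1]_i d i); first by apply: lt_bigmin => // i _; exact: (dP i).1.
by move=> i; apply: mono (dP i).2; exact: bigmin_le.
Qed.

Lemma l1_cont (I : finType) (c x : {ptws I -> R}) :
  {for x, continuous (fun y : {ptws I -> R} => l1 (sub y c))}.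
Proof.
apply/continuous_ptwsP => e e0; exists (e / (#|I|%:R + 1)).
  by rewrite divr_gt0// ltr_wpDl.
move=> y yx; rewrite /l1 -sumrB (le_lt_trans (ler_norm_sum _ _ _))//.
rewrite (@le_lt_trans _ _ (\sum_(i : I) e / (#|I|%:R + 1)))//.
  apply: ler_sum => i _; rewrite (le_trans (ler_dist_dist _ _))//.
  rewrite /sub (_ : _ - _ = y i - x i); last by ring.
  exact/ltW/yx.
rewrite sumr_const -[X in X < _]mulr_natr mulrAC ltr_pdivrMr ?ltr_wpDl//.
by rewrite ltr_pM2l// ltrDl.
Qed.

Lemma l1_small (I : finType) (c : {ptws I -> R}) (e : R) : 0 < e ->
  exists2 d : R, 0 < d & forall y : {ptws I -> R},
    (forall i, `|y i - c i| < d) -> l1 (sub y c) < e.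
Proof.
move=> e0; have /continuous_ptwsP/(_ e e0)[d d0 dP] := @l1_cont _ c c.
exists d => // y /dP; have -> : l1 (sub c c) = 0.
  by rewrite /l1 big1// => i _; rewrite /sub subrr normr0.
by rewrite subr0 ger0_norm ?l1_ge0.
Qed.

Lemma compact_l1_ball (I : finType) (c : {ptws I -> R}) (d : R) :
  compact [set x : {ptws I -> R} | l1 (sub x c) <= d].
Proof.
apply: (@subclosed_compact _ _ [set x : {ptws I -> R} | forall i, `[c i - d, c i + d]%classic (x i)]).
- rewrite (_ : [set _ | _] = (fun x : {ptws I -> R} => l1 (sub x c)) @^-1` [set t | t <= d])//.
  apply: closed_comp; last exact: closed_le.
  by move=> x _; exact: l1_cont.
- apply: (@tychonoff I (fun=> R) (fun i => `[c i - d, c i + d]%classic)) => i.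
  exact: segment_compact.
- move=> x /= xd i; rewrite in_itv/= -ler_distlC.
  by rewrite distrC (le_trans (le_l1 (sub x c) i)).
Qed.

Definition mul_fun n (A : 'M[R]_n) (v : 'I_n -> R) : 'I_n -> R :=
  fun i => \sum_j A i j * v j.

(** A bound for the operator norm from the sup norm to the l1 norm; the added [1] makes it positive,
    so that one can divide by it. *)
Definition mx_bound n (A : 'M[R]_n) : R := \sum_i \sum_j `|A i j| + 1.

Lemma mx_bound_gt0 n (A : 'M[R]_n) : 0 < mx_bound A.
Proof. by rewrite ltr_wpDl// sumr_ge0// => i _; rewrite sumr_ge0. Qed.

Lemma mul_fun_bound n (A : 'M[R]_n) (v : 'I_n -> R) (e : R) :
  0 <= e -> (forall j, `|v j| <= e) -> l1 (mul_fun A v) <= mx_bound A * e.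
Proof.
move=> e0 ve; rewrite mulrDl mul1r mulr_suml ler_wpDr//.
apply: ler_sum => i _; rewrite mulr_suml (le_trans (ler_norm_sum _ _ _))//.
by apply: ler_sum => j _; rewrite normrM ler_wpM2l.
Qed.

Lemma mul_funM n (A B : 'M[R]_n) (v : 'I_n -> R) :
  mul_fun A (mul_fun B v) = mul_fun (A *m B) v.
Proof.
apply/funext => i; rewrite /mul_fun; under eq_bigr do rewrite mulr_sumr.
rewrite exchange_big; apply: eq_bigr => j _; rewrite mxE mulr_suml.
by apply: eq_bigr => k _; rewrite mulrA.
Qed.

Lemma mul_fun1 n (v : 'I_n -> R) : mul_fun 1%:M v = v.
Proof.
apply/funext => i; rewrite /mul_fun (bigD1 i)//= big1 => [|j ji].
  by rewrite mxE eqxx mul1r addr0.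
by rewrite mxE eq_sym (negbTE ji) mul0r.
Qed.

Lemma mul_funB n (A : 'M[R]_n) (v w : 'I_n -> R) i :
  mul_fun A (fun j => v j - w j) i = mul_fun A v i - mul_fun A w i.
Proof. by rewrite /mul_fun -sumrB; apply: eq_bigr => j _; rewrite mulrBr. Qed.

Definition jacobian n (T : {ptws 'I_n -> R} -> {ptws 'I_n -> R}) x : 'M[R]_n :=
  \matrix_(b, a) partial a (fun y => T y b) x.

Lemma jacobian_det_neq0 n (T : {ptws 'I_n -> R} -> {ptws 'I_n -> R}) x :
  (forall u : 'I_n -> R,
     (forall b, \sum_a partial a (fun y => T y b) x * u a = 0) -> forall a, u a = 0) ->
  \det (jacobian T x) != 0.
Proof.
move=> H; rewrite -det_tr; apply/negP => /det0P[v v0 vA].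
move/negP: v0; apply; apply/eqP/rowP => a; rewrite !mxE; apply: (H (v ord0)) => b.
have /matrixP/(_ ord0 b) := vA; rewrite !mxE => vb; rewrite -[RHS]vb.
by apply: eq_bigr => i _; rewrite !mxE mulrC.
Qed.

Section LocalInverse.
Context (n : nat) (T : {ptws 'I_n -> R} -> {ptws 'I_n -> R}).
Context (U : set {ptws 'I_n -> R}) (x0 : {ptws 'I_n -> R}).
Hypothesis oU : open U.
Hypothesis Ux0 : U x0.
Hypothesis TU : forall k b, DC k U (fun x => T x b).

Lemma DC_jacobian k b a : DC k U (fun x => jacobian T x b a).
Proof.
apply: (@DC_ext _ _ _ _ (partial a (fun y => T y b))) => //.
  by move=> x _; rewrite mxE.
exact: ((TU k.+1 b).2 a).2.
Qed.

Lemma strict_jacobian (x : {ptws 'I_n -> R}) (e : R) : U x -> 0 < e ->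
  exists2 d : R, 0 < d & forall y z : {ptws 'I_n -> R},
    (forall i, `|y i - x i| < d) -> (forall i, `|z i - x i| < d) ->
    forall b, `|T z b - T y b - mul_fun (jacobian T x) (sub z y) b| <= e * l1 (sub z y).
Proof.
move=> Ux e0.
have [||d d0 dP] := @common_radius 'I_n (fun b d => forall y z : {ptws 'I_n -> R},
    (forall i, `|y i - x i| < d) -> (forall i, `|z i - x i| < d) ->
    `|T z b - T y b - mul_fun (jacobian T x) (sub z y) b| <= e * l1 (sub z y)).
- by move=> b r s rs H y z yr zr; apply: H => i; rewrite (lt_le_trans _ rs).
- move=> b; have [d d0 dP] := DC_strict oU (TU 1 b) Ux e0; exists d => // y z yd zd.
  have -> : mul_fun (jacobian T x) (sub z y) b =
      \sum_i partial i (fun x => T x b) x * (z i - y i).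
    by apply: eq_bigr => i _; rewrite mxE.
  exact: dP.
by exists d => // y z yd zd b; exact: dP.
Qed.

Hypothesis detJ : forall x, U x -> \det (jacobian T x) != 0.

Let M := invmx (jacobian T x0).
Let K := mx_bound M.

Lemma jacobianV x : U x -> invmx (jacobian T x) *m jacobian T x = 1%:M.
Proof. by move=> Ux; rewrite mulVmx// unitmxE unitfE detJ. Qed.

(** The map sending x to x - M T(x) has zero derivative at [x0]. Strict differentiability of [T]
    with error [1 / 2 / K], where [K] bounds [M], makes it Lipschitz of ratio 1/2 near [x0]. *)
Lemma contraction : exists2 d : R, 0 < d &
  (forall x : {ptws 'I_n -> R}, l1 (sub x x0) <= d -> U x) /\
  (forall x y : {ptws 'I_n -> R}, l1 (sub x x0) <= d -> l1 (sub y x0) <= d ->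
    l1 (fun i => (y i - x i) - mul_fun M (sub (T y) (T x)) i) <= l1 (sub y x) / 2).
Proof.
have K0 : 0 < K := mx_bound_gt0 M.
have [d d0 dP] := strict_jacobian Ux0 (divr_gt0 (divr_gt0 ltr01 (ltr0Sn _ 1)) K0).
have [a a0 aP] := open_ptwsP oU Ux0.
have lt_min2 (x : {ptws 'I_n -> R}) : l1 (sub x x0) <= Num.min a d / 2 ->
    forall i, `|x i - x0 i| < Num.min a d.
  move=> xd i; rewrite (le_lt_trans (le_l1 (sub x x0) i))// (le_lt_trans xd)//.
  by rewrite ltr_pdivrMr// ltr_pMr ?lt_min ?a0// ltr1n.
exists (Num.min a d / 2); first by rewrite divr_gt0// lt_min a0.
split=> [x /lt_min2 xd|x y /lt_min2 xd /lt_min2 yd].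
  by apply: aP => i; have := xd i; rewrite lt_min => /andP[].
have -> : (fun i => (y i - x i) - mul_fun M (sub (T y) (T x)) i) =
    mul_fun M (fun b => mul_fun (jacobian T x0) (sub y x) b - (T y b - T x b)).
  by apply/funext => i; rewrite mul_funB mul_funM jacobianV// mul_fun1.
rewrite (le_trans (mul_fun_bound _ (e := 1 / 2 / K * l1 (sub y x)) _ _))//.
- by rewrite mulr_ge0 ?l1_ge0// divr_ge0// ltW.
- move=> b; rewrite distrC; apply: dP => i.
    by have := xd i; rewrite lt_min => /andP[].
  by have := yd i; rewrite lt_min => /andP[].
- by rewrite -/K mulrA [K * _]mulrC divfK ?gt_eqF// mulrC div1r.
Qed.

Lemma l1_triangle (x y z : {ptws 'I_n -> R}) :
  l1 (sub x z) <= l1 (sub x y) + l1 (sub y z).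
Proof.
rewrite /l1 -big_split/=; apply: ler_sum => i _.
by rewrite /sub -(subrK (y i) (x i)) -addrA subrK ler_normD.
Qed.

(** Solving T(x) = y amounts to finding a fixed point of the contraction [S], which sends x to x - M
    (T(x) - y). Local injectivity makes the inverse [h] Lipschitz, hence differentiable, its
    derivative at y being the inverse of the Jacobian of [T] at [h y]; this formula raises the class
    of [h] by one at each induction step. *)
Lemma inverse_function :
  exists (V : set {ptws 'I_n -> R}) (h : {ptws 'I_n -> R} -> {ptws 'I_n -> R}),
  [/\ open V, V (T x0), (forall k i, DC k V (fun y => h y i)) &
    \forall x \near x0, V (T x) -> h (T x) = x].
Proof.
have K0 : 0 < K := mx_bound_gt0 M.
have [d d0 [dU dM]] := contraction.
have inj (x y : {ptws 'I_n -> R}) : l1 (sub x x0) <= d -> l1 (sub y x0) <= d ->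
    l1 (sub y x) <= 2 * K * l1 (sub (T y) (T x)).
  move=> xd yd; have H := dM x y xd yd.
  have MK : l1 (mul_fun M (sub (T y) (T x))) <= K * l1 (sub (T y) (T x)).
    by apply: mul_fun_bound => [|j]; [exact: l1_ge0|exact: le_l1].
  have : l1 (sub y x) <= l1 (fun i => (y i - x i) - mul_fun M (sub (T y) (T x)) i)
      + l1 (mul_fun M (sub (T y) (T x))).
    rewrite /l1 -big_split/=; apply: ler_sum => i _.
    by rewrite -{1}(subrK (mul_fun M (sub (T y) (T x)) i) (sub y x i)) ler_normD.
  by move: H MK; lra.
(* For y in [V] the map [S] below moves [x0] by less than [d / 2]; having ratio 1/2, it then sends
   the closed ball of radius [d] into the open one. *)
pose V : set {ptws 'I_n -> R} := [set y | K * l1 (sub y (T x0)) < d / 2].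
have oV : open V.
  rewrite (_ : V = (fun y : {ptws 'I_n -> R} => K * l1 (sub y (T x0))) @^-1`
    [set t | t < d / 2])//.
  apply: open_comp; last exact: open_lt.
  move=> y _; apply: (@continuousM R _ (cst K) (fun y : {ptws 'I_n -> R} => l1 (sub y (T x0)))).
    exact: cst_continuous.
  exact: l1_cont.
have surj y : V y -> exists x : {ptws 'I_n -> R}, l1 (sub x x0) < d /\ T x = y.
  move=> Vy.
  pose S (x : {ptws 'I_n -> R}) : {ptws 'I_n -> R} :=
    fun i => x i - mul_fun M (sub (T x) y) i.
  have SS (x z : {ptws 'I_n -> R}) : l1 (sub x x0) <= d -> l1 (sub z x0) <= d ->
      l1 (sub (S z) (S x)) <= l1 (sub z x) / 2.
    move=> xd zd; rewrite (le_trans _ (dM x z xd zd))//.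
    rewrite le_eqVlt; apply/orP; left; apply/eqP; congr l1; apply/funext => i.
    have -> : sub (T z) (T x) = fun j => sub (T z) y j - sub (T x) y j.
      by apply/funext => j; rewrite /sub; ring.
    by rewrite mul_funB /sub /S; ring.
  have S0 : l1 (sub (S x0) x0) < d / 2.
    apply: le_lt_trans Vy; rewrite -(_ : l1 (mul_fun M (sub y (T x0))) = l1 (sub (S x0) x0)).
      by apply: mul_fun_bound => [|j]; [exact: l1_ge0|exact: le_l1].
    congr l1; apply/funext => i; rewrite /sub /S.
    rewrite !mul_funB; ring.
  have Sd (x : {ptws 'I_n -> R}) : l1 (sub x x0) <= d -> l1 (sub (S x) x0) < d.
    move=> xd; rewrite (le_lt_trans (l1_triangle _ (S x0) _))//.
    have x0d : l1 (sub x0 x0) <= d.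
      by rewrite /l1 big1 ?ltW// => i _; rewrite /sub subrr normr0.
    by have := SS x0 x x0d xd; move: S0 xd; lra.
  (* The fixed point minimises the l1 distance between [x] and [S x] over the compact ball: applying
     [S] once more at least halves this distance, so the minimum is zero. *)
  have [||/= x /set_mem xB xmin] := @compact_EVT_min _ R
      (fun x : {ptws 'I_n -> R} => l1 (sub (S x) x)) _ _ (@compact_l1_ball _ x0 d).
  - exists x0 => /=; rewrite /l1 big1 ?ltW// => i _; by rewrite /sub subrr normr0.
  - apply: continuous_in_subspaceT => x /set_mem xB.
    have Ux : U x by exact: dU.
    apply: (@DC_cont _ _ 0 U) => //.
    apply: DC_sum => // i _.
    split=> // z Uz; apply: (@continuous_comp _ _ _ _ (fun t : R => `|t|)).
      suff W : DC 0 U (fun x => sub (S x) x i) by exact: (DC_cont W).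
      apply: (@DC_ext _ _ _ _ (fun x => -1 * mul_fun M (sub (T x) y) i)) => //.
        by move=> w _; rewrite /sub /S; ring.
      apply: DC_mul => //; first exact: DC_cst.
      apply: DC_sum => // j _; apply: DC_mul => //; first exact: DC_cst.
      by apply: DC_add => //; exact: DC_cst.
    exact: norm_continuous.
  have xS : forall i, S x i = x i.
    have := xmin (S x); rewrite inE => /(_ (ltW (Sd _ xB))).
    have := SS _ _ xB (ltW (Sd _ xB)).
    have := l1_ge0 (sub (S x) x) => H1 H2 H3 i.
    have H4 : l1 (sub (S x) x) = 0 by move: H1 H2 H3; lra.
    have := le_l1 (sub (S x) x) i; rewrite H4 normr_le0 subr_eq0 => /eqP; exact.
  exists x; split.
    by have := Sd x xB; rewrite (_ : S x = x)//; apply/funext.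
  have : mul_fun (jacobian T x0) (mul_fun M (sub (T x) y)) = fun=> 0.
    have -> : mul_fun M (sub (T x) y) = fun=> 0.
      apply/funext => i; have := xS i; rewrite /S => E.
      by move: E; lra.
    by apply/funext => i; rewrite /mul_fun big1// => j _; rewrite mulr0.
  rewrite mul_funM mulmxV ?unitmxE ?unitfE ?detJ// mul_fun1 => E.
  apply/funext => i; have /eqP := congr1 (fun f => f i) E.
  by rewrite subr_eq0 => /eqP.
pose inv_rel y (x : {ptws 'I_n -> R}) := V y -> l1 (sub x x0) < d /\ T x = y.
have /choice[h hP] y : exists x, inv_rel y x.
  have [/surj[x ?]|nV] := pselect (V y); first by exists x.
  by exists x0.
set L := 2 * K in inj; have L0 : 0 < L by rewrite mulr_gt0.
have lip y z : V y -> V z -> l1 (sub (h z) (h y)) <= L * l1 (sub z y).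
  move=> Vy Vz; have [yd Ty] := hP y Vy; have [zd Tz] := hP z Vz.
  by rewrite -{2}Ty -{2}Tz inj// ltW.
have hU y : V y -> U (h y) by move=> Vy; apply: dU; rewrite ltW//; exact: (hP y Vy).1.
have ch y i : V y -> {for y, continuous (fun y => h y i)}.
  move=> Vy; apply/continuous_ptwsP => e e0.
  have [a a0 aP] := open_ptwsP oV Vy.
  have [b b0 bP] := l1_small y (divr_gt0 e0 L0).
  exists (Num.min a b) => [|z zy]; first by rewrite lt_min a0.
  have Vz : V z by apply: aP => k; have := zy k; rewrite lt_min => /andP[].
  have : l1 (sub z y) < e / L.
    by apply: bP => k; have := zy k; rewrite lt_min => /andP[].
  rewrite ltr_pdivlMr// mulrC; apply: le_lt_trans.
  by rewrite (le_trans (le_l1 (sub (h z) (h y)) i))// lip.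
have dh y i j : V y -> pder j (fun y => h y i) y (invmx (jacobian T (h y)) i j).
  move=> Vy; apply/is_derive1P => e e0; rewrite upd_id.
  set N := invmx _; have N0 := mx_bound_gt0 N.
  have [d' d'0 d'P] := strict_jacobian (hU y Vy) (divr_gt0 e0 (mulr_gt0 L0 N0)).
  have [a a0 aP] := open_ptwsP oV Vy.
  exists (Num.min a (d' / L)) => [|t]; first by rewrite lt_min a0 divr_gt0.
  rewrite lt_min => /andP[ta]; rewrite ltr_pdivlMr// mulrC => td.
  set z := upd y j (y j + t).
  have zyE k : sub z y k = if k == j then t else 0.
    rewrite /sub /z /upd; case: eqP => [->|_]; last by rewrite subrr.
    by rewrite addrC addKr.
  have Vz : V z.
    by apply: aP => k; have := zyE k; rewrite /sub => ->; case: ifP; rewrite ?normr0.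
  have zy : l1 (sub z y) = `|t|.
    rewrite /l1 (bigD1 j)//= zyE eqxx big1 ?addr0// => k kj.
    by rewrite zyE (negbTE kj) normr0.
  have wx : l1 (sub (h z) (h y)) <= L * `|t| by rewrite -zy lip.
  have [_ Ty] := hP y Vy; have [_ Tz] := hP z Vz.
  have H b : `|mul_fun (jacobian T (h y)) (sub (h z) (h y)) b - sub z y b| <=
      e / (L * mx_bound N) * (L * `|t|).
    rewrite distrC /sub -{1}Ty -{1}Tz (le_trans (d'P _ _ _ _ b))//.
    - by move=> k; rewrite subrr normr0.
    - move=> k; rewrite (le_lt_trans (le_l1 (sub (h z) (h y)) k))//.
      exact: le_lt_trans td.
    - by rewrite ler_wpM2l// divr_ge0// ltW// mulr_gt0.
  (* Since z = T(h z) and y = T(h y), the vector to which [N] is applied is, up to sign, the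
     first-order error of [T] at [h y]. *)
  have -> : h z i - h y i - N i j * t = mul_fun N (fun b =>
      mul_fun (jacobian T (h y)) (sub (h z) (h y)) b - sub z y b) i.
    rewrite mul_funB mul_funM (jacobianV (hU y Vy)) mul_fun1; congr (_ - _).
    rewrite /mul_fun (bigD1 j)//= zyE eqxx big1 ?addr0// => k kj.
    by rewrite zyE (negbTE kj) mulr0.
  rewrite (le_trans (le_l1 _ i))// (le_trans (mul_fun_bound _ _ H))//.
    by rewrite mulr_ge0 ?(mulr_ge0 (ltW L0))// divr_ge0 ?(ltW e0)// ltW// mulr_gt0.
  rewrite le_eqVlt; apply/orP; left; apply/eqP; field.
  by rewrite !gt_eqF.
exists V, h; split => //.
- rewrite /V/= /l1 big1 ?mulr0 ?divr_gt0// => i _; by rewrite /sub subrr normr0.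
- elim=> [|k IH] i; first by split=> // y Vy; exact: ch.
  apply: (@DC_step _ _ _ _ _ (fun j y => invmx (jacobian T (h y)) i j)) => //.
  + by move=> y Vy; exact: ch.
  + by move=> j y Vy; exact: dh.
  + move=> j; apply: (DC_comp (U := U) (f := fun x => invmx (jacobian T x) i j)) => //.
    by apply: DC_invmx => // a b; exact: DC_jacobian.
(* Near [x0], both [x] and [h (T x)] lie in the ball on which [T] is injective, and they have the
   same image. *)
- have [a a0 aP] := l1_small x0 d0.
  suff : nbhs x0 [set x | V (T x) -> h (T x) = x] by [].
  apply/nbhs_ptwsP; exists a => // x /aP xd Vx.
  have [hd hT] := hP _ Vx.
  have := inj _ _ (ltW xd) (ltW hd); rewrite hT.
  have -> : l1 (sub (T x) (T x)) = 0.
    by rewrite /l1 big1// => i _; rewrite /sub subrr normr0.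
  rewrite mulr0 => l0; apply/funext => i.
  have := le_trans (le_l1 (sub (h (T x)) x) i) l0.
  by rewrite normr_le0 subr_eq0 => /eqP.
Qed.
End LocalInverse.

End InverseFunction.

(** * Open faces of polyhedra *)

Section Polyhedra.
Context {R : realType} (I J : finType) (N : J -> I -> R) (b : J -> R).
Implicit Types x y : {ptws I -> R}.

Definition dot (a : I -> R) x : R := \sum_(i : I) a i * x i.

Definition polyhedron : set {ptws I -> R} := [set x | forall j, b j <= dot (N j) x].

Definition tight x : {set J} := [set j | dot (N j) x == b j]%SET.

Definition comb (s t : R) x y : {ptws I -> R} := fun i => s * x i + t * y i.

Lemma dot_comb a s t x y : dot a (comb s t x y) = s * dot a x + t * dot a y.
Proof.
rewrite /dot !mulr_sumr -big_split/=; apply: eq_bigr => i _; rewrite /comb; ring.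
Qed.

Lemma midpoint_polyhedron x y : polyhedron x -> polyhedron y ->
  polyhedron (comb (1 / 2) (1 / 2) x y) /\
  tight (comb (1 / 2) (1 / 2) x y) = tight x :&: tight y.
Proof.
move=> Kx Ky; split=> [j|].
  by rewrite dot_comb; have := Kx j; have := Ky j; lra.
apply/finset.setP => j; rewrite !inE dot_comb; have := Kx j; have := Ky j => hy hx.
apply/eqP/andP => [E|[/eqP E /eqP F]]; last by rewrite E F; lra.
by split; apply/eqP; move: E hx hy; lra.
Qed.

(* x can be moved slightly away from y, since a constraint tight at x is tight
   at y as well. *)
Lemma extend_polyhedron x y : polyhedron x -> polyhedron y -> tight x \subset tight y ->
  exists2 t : R, 0 < t & polyhedron (comb (1 + t) (- t) x y).
Proof.
move=> Kx Ky /fintype.subsetP xy.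
(* The disjunct [t < 0] makes the condition pass to every smaller [t], as [common_radius]
   requires. *)
have [||t t0 tP] := @common_radius R J (fun j t =>
    b j <= dot (N j) (comb (1 + t) (- t) x y) /\ 0 <= t \/ t < 0).
- move=> j s t st [[H t0]|t0]; last by right; exact: le_lt_trans t0.
  have [s0|s0] := leP 0 s; last by right.
  left; split=> //; move: H; rewrite !dot_comb => H.
  have [D0|D0] := leP (dot (N j) y) (dot (N j) x); last first.
    have := ler_wpM2r (_ : 0 <= dot (N j) y - dot (N j) x) st.
    by rewrite subr_ge0 => /(_ (ltW D0)); move: H; lra.
  have := mulr_ge0 s0 (_ : 0 <= dot (N j) x - dot (N j) y).
  by rewrite subr_ge0 => /(_ D0); have := Kx j; lra.
- move=> j; have [jx|jx] := boolP (j \in tight x).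
    exists 1 => //; left; split=> //; rewrite dot_comb.
    by have := xy j jx; move: jx; rewrite !inE => /eqP -> /eqP ->; lra.
  have bx : b j < dot (N j) x.
    by rewrite lt_neqAle Kx andbT; move: jx; rewrite inE eq_sym.
  exists ((dot (N j) x - b j) / (`|dot (N j) y - dot (N j) x| + 1)).
    by rewrite divr_gt0 ?subr_gt0// ltr_wpDl.
  left; split; last by rewrite divr_ge0 ?subr_ge0 ?ltW// ltr_wpDl.
  set t := _ / _; rewrite dot_comb.
  have t0 : 0 <= t by rewrite divr_ge0 ?subr_ge0 ?ltW// ltr_wpDl.
  have tE : t * (`|dot (N j) y - dot (N j) x| + 1) = dot (N j) x - b j.
    by rewrite divfK// gt_eqF// ltr_wpDl.
  have := ler_wpM2l t0 (ler_norm (dot (N j) y - dot (N j) x)).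
  by move: tE t0; rewrite mulrDr mulr1 mulrBr; lra.
exists t => // j; have [[]//|] := tP j.
by rewrite ltNge (ltW t0).
Qed.

Definition face_at x : set {ptws I -> R} :=
  [set y | polyhedron y /\ tight x \subset tight y].

Lemma face_at_face x : polyhedron x -> face polyhedron (face_at x).
Proof.
move=> Kx; split; first by exists x.
(* On the polyhedron, minus the sum of the normals tight at [x] is maximal exactly where all these
   constraints are tight. *)
exists (fun i => - \sum_(j in tight x) N j i).
have aE y : \sum_(i : I) (- \sum_(j in tight x) N j i) * y i =
    - \sum_(j in tight x) dot (N j) y.
  rewrite /dot exchange_big -sumrN; apply: eq_bigr => i _.
  by rewrite mulNr mulr_suml.
apply/seteqP; split => y /=.
  move=> [Ky /fintype.subsetP xy]; split=> // z Kz; rewrite !aE lerN2.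
  apply: ler_sum => j jx; have := xy j jx; rewrite inE => /eqP ->; exact: Kz.
move=> [Ky /(_ x Kx)]; rewrite !aE lerN2 => H; split=> //.
apply/fintype.subsetP => j jx; rewrite inE.
have : \sum_(k in tight x) (dot (N k) y - b k) = 0.
  apply/eqP; rewrite eq_le sumr_ge0 ?andbT => [|k _]; last by rewrite subr_ge0.
  rewrite sumrB subr_le0 (le_trans H)// le_eqVlt; apply/orP; left; apply/eqP.
  by apply: eq_bigr => k; rewrite inE => /eqP.
move=> /eqP; rewrite psumr_eq0 => [/allP/(_ j (mem_index_enum j))|k _]; last first.
  by rewrite subr_ge0.
by rewrite jx /= subr_eq0.
Qed.

(** Take a point [x] of [F] with the fewest tight constraints. Its midpoint with any [y] in [F] is
    in [F], and by minimality [tight x] lies in [tight y]. Conversely, if [tight x] lies in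
    [tight y], the segment from [y] extends beyond [x]; as the functional is maximal at [x], it is
    no smaller at [y]. *)
Lemma faceP (F : set {ptws I -> R}) : face polyhedron F ->
  exists2 x, polyhedron x & F = face_at x.
Proof.
move=> [[x0 Fx0] [a FE]].
have ex : exists n, `[< exists2 x, F x & #|tight x| = n >].
  by exists #|tight x0|; apply/asboolP; exists x0.
case: (ex_minnP ex) => n /asboolP[x Fx xn] nmin; exists x; first by move: Fx; rewrite FE => -[].
have [Kx xmax] : polyhedron x /\ forall y, polyhedron y ->
    \sum_(i : I) a i * y i <= \sum_(i : I) a i * x i by move: Fx; rewrite FE.
apply/seteqP; split=> y.
  move=> Fy; have [Ky ymax] : polyhedron y /\ forall z, polyhedron z ->
    \sum_(i : I) a i * z i <= \sum_(i : I) a i * y i by move: Fy; rewrite FE.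
  split=> //.
  have [Kz zE] := midpoint_polyhedron Kx Ky; set z := comb _ _ x y in Kz zE.
  have Fz : F z.
    rewrite FE; split=> // w Kw; have := xmax w Kw; have := ymax w Kw.
    rewrite -!/(dot _ _) dot_comb; lra.
  have : (n <= #|tight z|)%N by apply: nmin; apply/asboolP; exists z.
  rewrite zE -xn => le; have : tight x :&: tight y == tight x.
    by rewrite eqEcard finset.subsetIl.
  by move=> /eqP <-; exact: finset.subsetIr.
move=> [Ky xy]; rewrite FE; split=> // z Kz.
have [t t0 Kt] := extend_polyhedron Kx Ky xy.
rewrite (le_trans (xmax z Kz))//.
have := xmax _ Kt; rewrite -!/(dot _ _) dot_comb => H.
have : t * dot a x <= t * dot a y by move: H; lra.
by rewrite ler_pM2l.
Qed.

Lemma open_facesP (E : set {ptws I -> R}) : open_faces polyhedron E <->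
  exists2 x, polyhedron x & E = [set y | polyhedron y /\ tight y = tight x].
Proof.
have fE x : polyhedron x -> face_at x `\` \bigcup_(F' in [set F' |
    face polyhedron F' /\ F' `<` face_at x]) F' =
    [set y | polyhedron y /\ tight y = tight x].
  move=> Kx; apply/seteqP; split=> y /=.
    move=> [[Ky xy] nU]; split=> //; apply/eqP; rewrite eq_sym finset.eqEsubset xy/=.
    apply/negPn/negP => nyx; apply: nU; exists (face_at y); last by split.
    split; first exact: face_at_face.
    split; first by move=> z [Kz yz]; split=> //; exact: fintype.subset_trans yz.
    by move=> /(_ x (conj Kx (fintype.subxx _)))[_]; rewrite (negbTE nyx).
  move=> [Ky yx]; split; first by split=> //; rewrite yx.
  move=> [F' [/faceP[z Kz ->] [_ nsub]] [_ zy]]; apply: nsub => w [Kw xw]; split=> //.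
  by apply: fintype.subset_trans xw; rewrite -yx.
split=> [[F /faceP[x Kx ->] ->]|[x Kx ->]]; first by exists x => //; exact: fE.
by exists (face_at x); [exact: face_at_face|rewrite fE].
Qed.

End Polyhedra.

(** * Sums over classes of edges, projective spaces and embeddings of compact spaces *)

Lemma ln_prod (R : realType) (I : Type) (s : seq I) (P : pred I) (F : I -> R) :
  (forall i, P i -> 0 < F i) ->
  ln (\prod_(i <- s | P i) F i) = \sum_(i <- s | P i) ln (F i).
Proof.
move=> F0; elim: s => [|i s IH]; first by rewrite !big_nil ln1.
rewrite !big_cons; case: ifP => // Pi; rewrite lnM ?posrE ?F0// ?IH//.
by rewrite prodr_gt0.
Qed.

Lemma cutoff_nondecreasing (R : realType) (a b s t : R) (h : R -> R) :
  cutoff a b h -> a <= s -> s <= t -> t <= 1 -> h s <= h t.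
Proof.
case=> _ h01 ha hinc h1 as_; rewrite le_eqVlt => /predU1P[->//|st] t1.
have [le|gt] := leP t b.
  apply/ltW/hinc => //; rewrite inE/= in_itv/= ?as_ ?le ?andbT ?(le_trans (ltW st))//.
  by rewrite (le_trans as_ (ltW st)).
rewrite [leRHS]h1; last by rewrite inE/= in_itv/= (ltW gt).
have /andP[]// : 0 <= h s <= 1.
by apply: h01; rewrite inE/= in_itv/= as_ (le_trans (ltW st)).
Qed.

(** * The pairing of a vector having zero class sums *)

Section ClassSums.
Context {R : realType} {m : nat} (G : graph m).
Variables (tau : {set coreset G}) (cl : 'I_m.+1 -> coreset G).
Hypothesis cl_tau : forall i, cl i \in tau.
Hypothesis mem_cl : forall i, i \in val (cl i).
Hypothesis cl_min : forall (S : coreset G) i, S \in tau -> i \in val S -> val (cl i) \subset val S.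
Variable u : 'I_m.+1 -> R.

Lemma sum_by_class (P : pred 'I_m.+1) (F : 'I_m.+1 -> R) :
  \sum_(i | P i) F i = \sum_(A : coreset G) \sum_(i | P i && (cl i == A)) F i.
Proof. exact: (partition_big cl xpredT). Qed.

(** Induction on the size of [A]. For [A] in [tau], the set [val A] is the disjoint union of the
    class of [A] and of classes of strictly smaller sets, whose sums vanish already. The class of an
    [A] outside [tau] is empty. *)
Lemma class_sum0 : (forall S : coreset G, S \in tau -> \sum_(i in val S) u i = 0) ->
  forall A : coreset G, \sum_(i | cl i == A) u i = 0.
Proof.
move=> uS A; have [k] := ubnP #|val A|; elim: k A => // k IH A Ak.
have [Atau|nAtau] := boolP (A \in tau); last first.
  by rewrite big1// => i /eqP iA; move: nAtau; rewrite -iA cl_tau.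
have := uS A Atau; rewrite (sum_by_class (fun i => i \in val A)) (bigD1 A)//.
rewrite /= [X in _ + X]big1 ?addr0 => [E|B BA].
  rewrite -[RHS]E; apply: eq_bigl => i.
  by have [<-|_] := eqVneq (cl i) A; rewrite ?andbF// mem_cl.
have [sBA|nBA] := boolP (val B \subset val A); last first.
  rewrite big1// => i /andP[iA /eqP iB]; move: nBA; rewrite -iB.
  by rewrite cl_min.
rewrite (eq_bigl (fun i => cl i == B)) => [|i]; last first.
  have [iB|_] := eqVneq (cl i) B; rewrite ?andbF// andbT.
  by rewrite (fintype.subsetP sBA)// -iB mem_cl.
apply: IH; rewrite -ltnS; apply: leq_trans Ak; rewrite ltnS.
by apply: proper_card; rewrite finset.properEneq sBA andbT; apply: contraNneq BA => /val_inj->.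
Qed.

Hypothesis u0 : forall A : coreset G, \sum_(i | cl i == A) u i = 0.

(** A class whose set [val A] lies inside [val S] is contained in [val S] as a whole, and its sum is
    zero. *)
Lemma sum_outside (S : coreset G) :
  \sum_(i in val S | ~~ (val (cl i) \subset val S)) u i = \sum_(i in val S) u i.
Proof.
rewrite [RHS](bigID (fun i => val (cl i) \subset val S))/=.
suff -> : \sum_(i in val S | val (cl i) \subset val S) u i = 0 by rewrite add0r.
rewrite sum_by_class big1// => A _.
have [AS|AS] := boolP (val A \subset val S).
  rewrite (eq_bigl (fun i => cl i == A))// => i.
  have [iA|_] := eqVneq (cl i) A; rewrite ?andbF// iA AS !andbT.
  by rewrite (fintype.subsetP AS)// -iA mem_cl.
by rewrite big1// => i /andP[/andP[_ H] /eqP iA]; rewrite iA (negbTE AS) in H.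
Qed.

(* The pairing of u with a vector that is constant on classes is zero; the
   sums over S regroup into u(S), so all terms of the pairing have one sign. *)
Lemma pairing_vanishes (l : 'I_m.+1 -> R) (a t : coreset G -> R) :
  (forall i, u i != 0 ->
     l i + \sum_(S : coreset G | (i \in val S) && ~~ (val (cl i) \subset val S)) a S
       = t (cl i)) ->
  (forall i, 0 <= u i * l i) ->
  (forall S : coreset G, 0 <= a S * \sum_(i in val S) u i) ->
  forall i, u i * l i = 0.
Proof.
move=> lat ul aS.
have E : \sum_i u i * l i + \sum_(S : coreset G) a S * \sum_(i in val S) u i = 0.
  transitivity (\sum_i u i * t (cl i)); last first.
    rewrite sum_by_class big1// => A _.
    transitivity ((\sum_(i | cl i == A) u i) * t A); last by rewrite u0 mul0r.
    by rewrite mulr_suml; apply: eq_bigr => i /= /eqP->.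
  have -> : \sum_(S : coreset G) a S * \sum_(i in val S) u i =
    \sum_i u i * \sum_(S : coreset G | (i \in val S) && ~~ (val (cl i) \subset val S)) a S.
    under [RHS]eq_bigr do rewrite mulr_sumr.
    rewrite (exchange_big_dep xpredT)//=; apply: eq_bigr => S _.
    by rewrite -sum_outside mulr_sumr; apply: eq_bigr => i _; rewrite mulrC.
  rewrite -big_split/=; apply: eq_bigr => i _; rewrite -mulrDr.
  by have [->|ui] := eqVneq (u i) 0; [rewrite !mul0r|rewrite lat].
have ul0 : \sum_i u i * l i = 0.
  have := sumr_ge0 _ (fun S (_ : true) => aS S); have := sumr_ge0 _ (fun i (_ : true) => ul i).
  by move=> H1 H2; apply/eqP; rewrite eq_le H1 andbT -[leRHS]E lerDl.
move=> i; apply/eqP; move/eqP: ul0; rewrite psumr_eq0// => /allP/(_ i (mem_index_enum i)).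
by rewrite implyTb.
Qed.

End ClassSums.

Section ProjectiveSpace.
Context {R : realType} {I : finType}.
Implicit Types v w : @nonzero R I.

Lemma line_ofP v w : line_of v = line_of w <->
  exists2 k : R, k != 0 & forall i, set_val w i = k * set_val v i.
Proof.
split=> [/eqquotP/asboolP//|H]; apply/eqquotP; exact/asboolP.
Qed.

Lemma hcoord_line_of v : exists2 k : R, k != 0 &
  forall i, hcoord (line_of v) i = k * set_val v i.
Proof.
by apply/line_ofP; rewrite /line_of reprK.
Qed.

Lemma hcoord_ratio v i : hcoord (line_of v) i / \sum_j hcoord (line_of v) j =
  set_val v i / \sum_j set_val v j.
Proof.
have [k k0 kE] := hcoord_line_of v; rewrite kE.
under eq_bigr do rewrite kE.
by rewrite -mulr_sumr invfM mulrACA divff// mul1r.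
Qed.

Lemma simplex_open_face_line_of (B : {set I}) v : (forall i, 0 <= set_val v i) ->
  simplex_open_face B (line_of v) <-> B = [set i | set_val v i != 0]%SET.
Proof.
move=> v0; split=> [[w /line_ofP[k k0 kE] wB]|->].
  apply/finset.setP => i; rewrite inE; have [wi nwi] := wB i.
  have [iB|iB] := boolP (i \in B).
    have := wi iB; rewrite kE => H; apply/esym; apply: contraTneq H => ->.
    by rewrite mulr0 ltxx.
  have /eqP := nwi iB; rewrite kE mulf_eq0 (negbTE k0)/= => /eqP ->.
  by rewrite eqxx.
exists v => // i; rewrite inE; split=> [vi|/negPn/eqP//].
by rewrite lt_neqAle eq_sym vi v0.
Qed.

End ProjectiveSpace.

Lemma cvg_prod_topology (T : Type) (I : eqType) (K : I -> topologicalType)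
    (F : set_system T) (f : T -> prod_topology K) (l : prod_topology K) : Filter F ->
  (forall i, (fun t => f t i) @ F --> l i) -> f @ F --> l.
Proof.
move=> FF H; apply/cvg_sup => i; apply/cvg_image.
  rewrite eqEsubset; split => // t _; exists (dfwith l i t) => //.
  by rewrite dfwithin.
move=> B /(H i) FB; exists ((fun z : prod_topology K => z i) @^-1` B); first exact: FB.
rewrite eqEsubset; split => [t [y /= By <-]//|t Bt].
by exists (dfwith l i t); rewrite /= dfwithin.
Qed.

Lemma hausdorff_ptws (R : realType) (I : eqType) : hausdorff_space {ptws I -> R}.
Proof. by apply: hausdorff_product => _; exact: Rhausdorff. Qed.

(** * Embeddings of compact spaces *)

Section CompactEmbedding.
Context {X Y : topologicalType} (K : set X) (f : X -> Y).
Hypothesis compK : compact K.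
Hypothesis contf : {within K, continuous f}.
Hypothesis injf : forall x y, K x -> K y -> f x = f y -> x = y.

(** [O] is the complement of the image of [K] minus the interior of [W], a compact and hence closed
    set. The lemma expresses the continuity of the inverse of [f] at [f x]: a point of [K] with
    image close to [f x] is close to [x]. *)
Lemma compact_separation (x : X) (W : set X) : hausdorff_space Y -> K x -> nbhs x W ->
  exists O : set Y, [/\ open O, O (f x) & forall y, K y -> O (f y) -> W y].
Proof.
move=> hY Kx xW; exists (~` (f @` (K `&` ~` W°))); split.
- suff H : compact (f @` (K `&` ~` W°)) by exact: closed_openC (compact_closed hY H).
  apply: (@continuous_compact _ _ f).
    by apply: continuous_subspaceW contf => z [].
  by apply: compact_closedI => //; exact/open_closedC/open_interior.
- by move=> [y [Ky nWy] /injf yx]; apply: nWy; rewrite yx.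
- move=> y Ky nfy; apply: contrapT => nW; apply: nfy; exists y => //; split => //.
  by move=> /interior_subset.
Qed.

End CompactEmbedding.

(** The compactness argument is run in the Hausdorff space [Z] for the composite of [b] and [f];
    continuity of [b] at [f x] pulls the resulting neighbourhood back to [Y]. *)
Lemma homeo_of_chart (X Y Z : topologicalType) (x0 : X) (K : set X) (f : X -> Y)
    (b : Y -> Z) : compact K -> hausdorff_space Z -> {within K, continuous f} ->
  (forall x, K x -> {for f x, continuous b}) ->
  (forall x y, K x -> K y -> b (f x) = b (f y) -> x = y) ->
  homeo_onto_image K f.
Proof.
move=> cK hZ cf cb inj; split=> //.
have cbf : {within K, continuous (b \o f)}.
  by apply: within_continuous_comp => // y /set_mem[x Kx <-]; exact: cb.
have /choice[h hP] y : exists x, forall z, K z -> b (f z) = b y -> x = z.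
  have [[x [Kx xy]]|nex] := pselect (exists x, K x /\ b (f x) = b y).
    by exists x => z Kz zy; apply: inj => //; rewrite xy zy.
  by exists x0 => z Kz zy; exfalso; apply: nex; exists z.
have hf x : K x -> h (f x) = x by move=> Kx; exact: hP.
exists h; split=> //; apply/subspace_continuousP => _ [x Kx <-].
move=> W hxW; have xW : nbhs x W by rewrite -[x](hf x Kx).
have [Q [oQ Qx QW]] := compact_separation cK cbf inj hZ Kx xW.
have bO : nbhs (f x) (b @^-1` Q) by apply: cb => //; exact: open_nbhs_nbhs.
apply: filterS bO => y /= Oy [z Kz zy]; have hy := hf z Kz; rewrite zy in hy.
suff : W (h y) by []; rewrite hy.
by apply: QW => //=; rewrite zy.
Qed.

Section ProjectiveTopology.
Context {R : realType} {I : finType}.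

Lemma cvg_nonzero (T : Type) (F : set_system T) (f : T -> @nonzero R I) (l : @nonzero R I) :
  Filter F -> (forall i, (fun t => set_val (f t) i) @ F --> set_val l i) -> f @ F --> l.
Proof.
move=> FF H; have {}H : (fun t => set_val (f t) : {ptws I -> R}) @ F --> (set_val l : {ptws I -> R}).
  exact: cvg_prod_topology.
move=> B [_ /= [[W oW <-] /= Wl] WB].
have : nbhs (set_val l) W by exact: open_nbhs_nbhs.
by move=> /H; rewrite nbhs_simpl/=; apply: filterS => t; exact: WB.
Qed.

Definition ratio (i : I) (q : proj_space R I) : R := hcoord q i / \sum_j hcoord q j.

(** A set is open in the quotient when its preimage among the nonzero vectors is. The neighbourhood
    is cut out by conditions invariant under scaling: a nonzero coordinate sum, and the ratio lying
    in the given open set. *)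
Lemma ratio_continuous (i : I) (v : @nonzero R I) : \sum_j set_val v j != 0 ->
  {for line_of v, continuous (ratio i)}.
Proof.
move=> v0 B; rewrite nbhsE => -[Q [oQ Qq] QB].
pose D : set {ptws I -> R} :=
  [set x | \sum_j x j != 0 /\ Q (x i / \sum_j x j)].
have oD : open D.
  rewrite openE => x [x0 Qx].
  have cs : {for x, continuous (fun x : {ptws I -> R} => \sum_j x j)}.
    apply: (@DC_cont _ _ 0 setT) => //; apply: DC_sum => [|j _]; first exact: openT.
    by apply: DC_coord; exact: openT.
  have cr : {for x, continuous (fun x : {ptws I -> R} => x i / \sum_j x j)}.
    apply: (@continuousM R _ (fun x : {ptws I -> R} => x i)
      (fun x : {ptws I -> R} => (\sum_j x j)^-1)); first exact: cont_coord.
    exact: (@continuousV R _ (fun x : {ptws I -> R} => \sum_j x j)).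
  apply: filterI.
    apply: (cs [set t : R | t != 0]); apply: open_nbhs_nbhs; split; first exact: open_neq.
    exact: x0.
  by apply: cr; exact: open_nbhs_nbhs.
have ratioE w : ratio i (line_of w) = set_val w i / \sum_j set_val w j.
  exact: hcoord_ratio.
have oT : open [set q : proj_space R I | \sum_j hcoord q j != 0 /\ Q (ratio i q)].
  have : open ((set_val : @nonzero R I -> {ptws I -> R}) @^-1` D) by exists D.
  congr open; apply/funext => w; apply/propext.
  have [k k0 kE] := hcoord_line_of w.
  have -> : (set_val @^-1` D) w = (\sum_j set_val w j != 0 /\ Q (ratio i (line_of w))).
    by rewrite ratioE.
  have -> : \sum_j set_val w j != 0 = (\sum_j hcoord (line_of w) j != 0).
    under [in RHS]eq_bigr do rewrite kE.
    by rewrite -mulr_sumr mulf_eq0 negb_or k0.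
  by [].
have : nbhs (line_of v) [set q : proj_space R I | \sum_j hcoord q j != 0 /\ Q (ratio i q)].
  apply: open_nbhs_nbhs; split=> //; split=> //.
  have [k k0 kE] := hcoord_line_of v; under eq_bigr do rewrite kE.
  by rewrite -mulr_sumr mulf_neq0.
by apply: filterS => q [_]; exact: QB.
Qed.

End ProjectiveTopology.

(** * Smooth functions of one real variable and rules for derivatives *)

Section SmoothRealFunctions.
Context {R : realType}.

Definition smooth1 (F : R -> R) := forall (k : nat) (x : R), derivable (derive1n k F) x 1.

Lemma smooth1_derive1 F : smooth1 F -> smooth1 (derive1 F).
Proof. by move=> sF k x; rewrite -derive1Sn; exact: sF. Qed.

Lemma smooth1_is_derive F x : smooth1 F -> is_derive x (1 : R) F (derive1 F x).
Proof. by move=> /(_ 0%N x) dF; rewrite derive1E; exact: derivableP. Qed.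

(** The real line is viewed as its power with exponent [unit], so that [DC_comp] applies to
    compositions with [F]. *)
Lemma DC_smooth1 k F : smooth1 F -> DC k setT (fun z : {ptws unit -> R} => F (z tt)).
Proof.
have cF G : smooth1 G -> forall z : {ptws unit -> R}, {for z, continuous (fun z : {ptws unit -> R} => G (z tt))}.
  move=> sG z; apply: (@continuous_comp _ _ _ (fun z : {ptws unit -> R} => z tt) G).
    exact: cont_coord.
  by apply: differentiable_continuous; apply/derivable1_diffP; exact: (sG 0%N).
elim: k F => [|k IH] F sF; first by split=> // z _; exact: cF.
apply: (@DC_step _ _ _ _ _ (fun _ z => derive1 F (z tt))); first exact: openT.
- by move=> z _; exact: cF.
- by move=> [] z _; exact: smooth1_is_derive.
- by move=> _; apply: IH; exact: smooth1_derive1.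
Qed.

Lemma DC_smooth1_comp (I : finType) k U F (f : {ptws I -> R} -> R) : open U ->
  smooth1 F -> DC k U f -> DC k U (fun x => F (f x)).
Proof.
move=> oU sF fU.
apply: (DC_comp (U := setT) (f := fun z : {ptws unit -> R} => F (z tt)) (h := fun x _ => f x)) => //.
  exact: openT.
exact: DC_smooth1.
Qed.

(** Only smaller arguments are compared: [x] may be the right end 1 of the interval on which the
    smooth extension agrees with g_r. *)
Lemma derive_ge0_left (F : R -> R) (a x d : R) : is_derive x (1 : R) F d -> a < x ->
  (forall y, a <= y -> y <= x -> F y <= F x) -> 0 <= d.
Proof.
move=> /is_derive1P dF ax Fm; rewrite leNgt; apply/negP => d0.
have [k k0 kP] := dF (- d / 2) (divr_gt0 (etrans (oppr_gt0 d) d0) (ltr0Sn _ 1)).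
pose h := Num.min (k / 2) (x - a).
have h0 : 0 < h by rewrite lt_min divr_gt0//= subr_gt0.
have hk : `|- h| < k.
  by rewrite normrN gtr0_norm// (le_lt_trans (_ : h <= k / 2))// ?ge_min ?lexx//; lra.
have ha : h <= x - a by rewrite ge_min lexx orbT.
have := kP _ hk; rewrite normrN (gtr0_norm h0) ler_norml => /andP[H _].
have le : F (x - h) <= F x by apply: Fm; move: ha h0; lra.
have dh : d * h < 0 by rewrite nmulr_rlt0.
by move: H le dh; rewrite mulrN; lra.
Qed.

(** The value is written through logarithmic derivatives, so that the contributions of the ln
    g_S(x_S) appear as separate summands. *)
Lemma is_derive_prod (I : Type) (s : seq I) (P : pred I) (f : I -> R -> R) (d : I -> R) (t : R) :
  (forall i, P i -> f i t != 0 /\ is_derive t (1 : R) (f i) (d i)) ->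
  is_derive t (1 : R) (fun u => \prod_(i <- s | P i) f i u)
    ((\prod_(i <- s | P i) f i t) * \sum_(i <- s | P i) d i / f i t).
Proof.
move=> fd; elim: s => [|i s IH].
  rewrite !big_nil mulr0.
  rewrite (_ : (fun _ => _) = cst 1); first exact: is_derive_cst.
  by apply/funext => u; rewrite big_nil.
rewrite !big_cons; under eq_fun do rewrite big_cons; case: ifPn => // Pi.
have [f0 fi] := fd i Pi; apply: is_derive_eq (is_deriveM fi IH) _.
by rewrite -![_ *: _]/(_ * _); field; rewrite f0.
Qed.

Lemma is_derive_bigsum (I : Type) (s : seq I) (P : pred I) (f : I -> R -> R)
    (d : I -> R) (t : R) : (forall i, P i -> is_derive t (1 : R) (f i) (d i)) ->
  is_derive t (1 : R) (fun u => \sum_(i <- s | P i) f i u) (\sum_(i <- s | P i) d i).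
Proof.
move=> fd; elim: s => [|i s IH].
  rewrite big_nil (_ : (fun _ => _) = cst 0); first exact: is_derive_cst.
  by apply/funext => u; rewrite big_nil.
rewrite big_cons; under eq_fun do rewrite big_cons; case: ifPn => // Pi.
by apply: is_deriveD; first exact: fd.
Qed.

Lemma is_derive_near (f h : R -> R) (t a b : R) : (\forall u \near t, f u = h u) ->
  is_derive t (1 : R) f a -> is_derive t (1 : R) h b -> a = b.
Proof. by move=> fh [_ <-] [_ <-]; exact: near_eq_derive. Qed.

Lemma is_derive_affine (a b t : R) : is_derive t (1 : R) (fun u => a + u * b) b.
Proof.
apply/is_derive1P => e e0; exists 1 => // h _.
rewrite (_ : _ - _ = 0); last by ring.
by rewrite normr0 mulr_ge0 ?(ltW e0).
Qed.

Lemma is_derive_mul (f h : R -> R) (t a b : R) :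
  is_derive t (1 : R) f a -> is_derive t (1 : R) h b ->
  is_derive t (1 : R) (fun u => f u * h u) (f t * b + h t * a).
Proof. by move=> fa hb; exact: is_deriveM. Qed.

End SmoothRealFunctions.

(** * The jewel and the map p_core *)

Section JewelFacts.
Context {R : realType} {m : nat} (G : graph m) (n : nat).
Hypothesis rankG : h1rank G [set: 'I_m.+1]%SET = n.
Hypothesis no_sep : forall i : 'I_m.+1, ~~ separating G i.
Variables (c : nat -> R) (g : nat -> R -> R).
Hypothesis c1_gt0 : 0 < c 1%N.
Hypothesis c_double : forall r : nat, (1 <= r < n)%N -> 2%:R * c r < c r.+1.
Hypothesis g_cutoff : forall r : nat, (1 <= r < n)%N -> cutoff (c r) (c r.+1) (g r).

Local Notation rk S := (h1rank G (val S)).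
Local Notation Delta := 'I_m.+1.
Local Notation cS := (coreset G).
Implicit Types (S A B : cS) (i j : Delta) (x y : {ptws Delta -> R}).

Lemma setT_core : core G [set: Delta]%SET && ([set: Delta]%SET != finset.set0).
Proof. by rewrite core_setT//=; apply/set0Pn; exists ord0; rewrite inE. Qed.

Definition Top : cS := exist (fun A : {set Delta} => core G A && (A != finset.set0)) _ setT_core.

Lemma core_val S : core G (val S).
Proof. by case/andP: (valP S). Qed.

Lemma rk_gt0 S : (1 <= rk S)%N.
Proof. by case/andP: (valP S) => *; exact: core_h1rank_gt0. Qed.

Lemma rk_le S : (rk S <= n)%N.
Proof. by rewrite -rankG; apply: h1rank_mono; exact: finset.subsetT. Qed.

Lemma rk_lt S A : val S \proper val A -> (rk S < rk A)%N.
Proof. by move=> SA; apply: core_h1rank_lt => //; exact: core_val. Qed.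

Lemma rk_ltn S : S != Top -> (1 <= rk S < n)%N.
Proof.
move=> ST; rewrite rk_gt0 -rankG (@rk_lt S Top)//= finset.properEneq finset.subsetT andbT.
by apply: contra_neq ST => E; apply: val_inj.
Qed.

Lemma unionP S A : core G (val S :|: val A) && (val S :|: val A != finset.set0).
Proof.
rewrite coreU ?core_val//=; case/andP: (valP S) => _ /set0Pn[i iS].
by apply/set0Pn; exists i; rewrite inE iS.
Qed.

Definition union S A : cS :=
  exist (fun A : {set Delta} => core G A && (A != finset.set0)) _ (unionP S A).

Lemma c_gt0 r : (1 <= r <= n)%N -> 0 < c r.
Proof.
elim: r => // -[//|r] IH /andP[_ rn].
have r0 : 0 < c r.+1 by apply: IH; lia.
by have := c_double (r := r.+1); rewrite /= rn => /(_ isT); lra.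
Qed.

Lemma c_lt r s : (1 <= r)%N -> (r < s <= n)%N -> 2%:R * c r < c s.
Proof.
move=> r1; elim: s => // s IH /andP[rs sn].
have sd : 2%:R * c s < c s.+1 by apply: c_double; lia.
have [E|E] := eqVneq r s; first by rewrite E.
have rs' : 2%:R * c r < c s by apply: IH; lia.
have s0 : 0 < c s by apply: c_gt0; lia.
by move: rs' sd s0; lra.
Qed.

Lemma vol_unionE x (A B : {set Delta}) :
  vol (A :|: B) x = vol A x + vol (B :\: A) x.
Proof.
rewrite /vol [LHS](bigID (mem A))/=; congr (_ + _); apply: eq_bigl => i;
  by rewrite !inE; case: (i \in A) => //=; rewrite ?orbT ?andbT ?andbF.
Qed.

Lemma vol_mono x (A B : {set Delta}) : (forall i, 0 <= x i) -> A \subset B ->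
  vol A x <= vol B x.
Proof.
by move=> x0 AB; rewrite -(finset.setUidPr AB) vol_unionE lerDl sumr_ge0.
Qed.

Section Point.
Variable x : {ptws Delta -> R}.
Hypothesis Px : jewel G c x.

Lemma jewel_ge0 i : 0 <= x i. Proof. by case: Px. Qed.
Lemma jewel_top : vol [set: Delta]%SET x = 1. Proof. by case: Px. Qed.
Lemma jewel_core S : c (rk S) <= vol (val S) x. Proof. by case: Px. Qed.

Lemma jewel_le1 S : vol (val S) x <= 1.
Proof. by rewrite -jewel_top vol_mono ?finset.subsetT//; exact: jewel_ge0. Qed.

Lemma vol_le_union (A B : {set Delta}) : vol (A :|: B) x <= vol A x + vol B x.
Proof.
rewrite vol_unionE lerD2l vol_mono ?finset.subsetDl//; exact: jewel_ge0.
Qed.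

Lemma vol_gt0 S : 0 < vol (val S) x.
Proof. by apply: lt_le_trans (jewel_core S); apply: c_gt0; rewrite rk_gt0 rk_le. Qed.

Lemma vol_gt0_ex S : exists2 i, i \in val S & x i != 0.
Proof.
apply/exists_inP; apply: contraTT (vol_gt0 S) => /exists_inPn H.
by rewrite /vol big1 ?ltxx// => i /H /negPn/eqP.
Qed.

End Point.

(** * The chain of tight core subsets *)

Definition tight_cores x : {set cS} := [set S : cS | vol (val S) x == c (rk S)]%SET.
Definition zero_set x : {set Delta} := [set i | x i == 0]%SET.
Definition chain x : {set cS} := (Top |: tight_cores x)%SET.

Lemma in_chain x S : S \in chain x = (S == Top) || (vol (val S) x == c (rk S)).
Proof. by rewrite !inE. Qed.

(** If neither tight set contained the other, their union would be core of larger rank than both.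
    Its volume is at most the sum of the two tight volumes, each of which is less than half of the
    bound required for the union. *)
Lemma chain_total x S A : jewel G c x -> S \in chain x -> A \in chain x ->
  (val S \subset val A) || (val A \subset val S).
Proof.
move=> Px; rewrite !in_chain => /predU1P[->|/eqP tS]; first by rewrite finset.subsetT orbT.
move=> /predU1P[->|/eqP tA]; first by rewrite finset.subsetT.
apply: contraT; rewrite negb_or => /andP[nSA nAS].
have rS : (rk S < rk (union S A))%N.
  apply: rk_lt; rewrite properE finset.subsetUl/=; apply: contra nAS.
  by rewrite finset.subUset => /andP[].
have rA : (rk A < rk (union S A))%N.
  apply: rk_lt; rewrite properE finset.subsetUr/=; apply: contra nSA.
  by rewrite finset.subUset => /andP[].
have := vol_le_union Px (val S) (val A); rewrite tS tA.
have /= := jewel_core Px (union S A).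
have := c_lt (rk_gt0 S) (s := rk (union S A)); rewrite rS rk_le => /(_ isT).
have := c_lt (rk_gt0 A) (s := rk (union S A)); rewrite rA rk_le => /(_ isT).
by rewrite /=; lra.
Qed.

(** A strictly larger core subset has larger rank, and its volume must then exceed the tight volume
    of [S]. *)
Lemma tight_max x S A : jewel G c x -> vol (val S) x = c (rk S) ->
  val S \subset val A -> vol (val A) x = vol (val S) x -> A = S.
Proof.
move=> Px tS SA AS; apply/eqP; apply: contraT => nAS.
have rSA : (rk S < rk A)%N.
  by apply: rk_lt; rewrite finset.properEneq SA andbT; apply: contraNneq nAS => /val_inj->.
have := c_lt (rk_gt0 S) (s := rk A); rewrite rSA rk_le => /(_ isT).
have := jewel_core Px A; rewrite AS tS.
have := c_gt0 (r := rk S); rewrite rk_gt0 rk_le => /(_ isT); lra.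
Qed.

Lemma smallest_ex x i : (Top \in chain x) && (i \in val Top).
Proof. by rewrite in_chain eqxx/= inE. Qed.

(** The set cl(i). For [x] in the jewel the chain is ordered by inclusion, so least cardinality
    means smallest; [Top] makes the choice possible for every [i]. *)
Definition smallest x i : cS :=
  [arg min_(S < Top | (S \in chain x) && (i \in val S)) #|val S|]%N.

Lemma smallestP x i : [/\ smallest x i \in chain x, i \in val (smallest x i) &
  forall S, S \in chain x -> i \in val S -> (#|val (smallest x i)| <= #|val S|)%N].
Proof.
rewrite /smallest; case: arg_minnP; first exact: smallest_ex.
by move=> S /andP[? ?] H; split=> // A ? ?; apply: H; apply/andP.
Qed.

Lemma smallest_chain x i : smallest x i \in chain x. Proof. by case: (smallestP x i). Qed.
Lemma mem_smallest x i : i \in val (smallest x i). Proof. by case: (smallestP x i). Qed.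

Lemma smallest_sub x S i : jewel G c x -> S \in chain x -> i \in val S ->
  val (smallest x i) \subset val S.
Proof.
move=> Px Sx iS; have [sx _ H] := smallestP x i.
case/orP: (chain_total Px sx Sx) => // sub.
by have /eqP -> : val S == val (smallest x i) by rewrite eqEcard sub H.
Qed.

Section Cutoffs.
Variable x : {ptws Delta -> R}.
Hypothesis Px : jewel G c x.

Lemma vol_itv S : vol (val S) x \in `[c (rk S), 1]%classic.
Proof. by rewrite inE/= in_itv/= jewel_core// jewel_le1. Qed.

Lemma cutoff_ge0 S : S != Top -> 0 <= g (rk S) (vol (val S) x).
Proof. by move=> /rk_ltn/g_cutoff[_ /(_ _ (vol_itv S))/andP[]]. Qed.

Lemma cutoff_eq0 S : S != Top ->
  (g (rk S) (vol (val S) x) == 0) = (vol (val S) x == c (rk S)).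
Proof.
move=> /rk_ltn rS; have [_ _ g0 ginc g1] := g_cutoff rS.
have [->|nt] := eqVneq (vol (val S) x) (c (rk S)); first by rewrite g0 eqxx.
have lt : c (rk S) < vol (val S) x by rewrite lt_neqAle eq_sym nt jewel_core.
have cc : c (rk S) < c (rk S).+1.
  have := c_double rS; have := c_gt0 (r := rk S).
  by case/andP: rS => -> /ltnW-> /(_ isT); lra.
have [le|gt] := leP (vol (val S) x) (c (rk S).+1).
  apply/negbTE; rewrite gt_eqF// -g0 ginc// inE/= in_itv/= ?lexx ?(ltW cc)//.
  by rewrite (ltW lt) le.
by rewrite g1 ?oner_eq0// inE/= in_itv/= (ltW gt) jewel_le1.
Qed.

Lemma cutoff_mono y S : jewel G c y -> S != Top ->
  vol (val S) x <= vol (val S) y -> g (rk S) (vol (val S) x) <= g (rk S) (vol (val S) y).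
Proof.
move=> Py /rk_ltn/g_cutoff rS le.
by apply: cutoff_nondecreasing rS _ le _; [exact: jewel_core|exact: jewel_le1].
Qed.

End Cutoffs.

Lemma sub_neq_Top (A S : cS) : ~~ (val A \subset val S) -> S != Top.
Proof. by apply: contraNneq => ->; rewrite finset.subsetT. Qed.

(** * Supports of the vectors pi_A(x) *)

Section Support.
Variable x : {ptws Delta -> R}.
Hypothesis Px : jewel G c x.

Lemma pi_map_ge0 A (i : edges_of A) : 0 <= pi_map G g A x i.
Proof.
rewrite /pi_map mulr_ge0 ?jewel_ge0// prodr_ge0// => S /andP[_ /sub_neq_Top ST].
exact: cutoff_ge0.
Qed.

Lemma pi_map_neq0P A (i : edges_of A) : reflect
  (x (val i) != 0 /\ forall S, val i \in val S -> ~~ (val A \subset val S) ->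
    S \notin tight_cores x) (pi_map G g A x i != 0).
Proof.
rewrite /pi_map mulf_eq0 negb_or; apply: (iffP andP) => -[xi H]; split=> //.
  move=> S iS AS; move/prodf_neq0: H => /(_ S); rewrite iS AS => /(_ isT).
  by rewrite cutoff_eq0 ?(sub_neq_Top AS)// inE.
apply/prodf_neq0 => S /andP[iS AS].
by rewrite cutoff_eq0 ?(sub_neq_Top AS)//; have := H S iS AS; rewrite inE.
Qed.

(** A tight core subset containing [i] is in the chain, hence contains [smallest x i], and
    contributes no factor to this coordinate. *)
Lemma pi_map_smallest i : x i != 0 ->
  pi_map G g (smallest x i) x (exist _ i (mem_smallest x i)) != 0.
Proof.
move=> xi; apply/pi_map_neq0P; split=> //= S iS; apply: contra => Sx.
by apply: smallest_sub => //; rewrite in_setU1 Sx orbT.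
Qed.

(** Otherwise every [i] in [A] with x_i nonzero lies in a tight set not containing [A]. The largest
    tight set [S] not containing [A] then contains all these [i], so the union of [S] and [A] has
    the volume of [S]; by [tight_max] it equals [S], which therefore contains [A]. *)
Lemma pi_map_neq0 A : exists i : edges_of A, pi_map G g A x i != 0.
Proof.
apply: contrapT => nex.
have H i (iA : i \in val A) : x i != 0 ->
    exists2 S, S \in tight_cores x & (i \in val S) && ~~ (val A \subset val S).
  move=> xi; apply: contrapT => nS; apply: nex; exists (exist _ i iA).
  apply/pi_map_neq0P; split=> //= S iS AS; apply/negP => Sx; apply: nS.
  by exists S => //; rewrite iS.
have [i0 i0A xi0] := vol_gt0_ex Px A.
have [S0 S0x /andP[_ AS0]] := H i0 i0A xi0.
pose P S := (S \in tight_cores x) && ~~ (val A \subset val S).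
have PS0 : P S0 by rewrite /P S0x.
case: (arg_maxnP (fun S : cS => #|val S|) PS0) => S /andP[Sx AS] Smax.
have chain_tight B : B \in tight_cores x -> B \in chain x.
  by move=> Bx; rewrite in_setU1 Bx orbT.
suff E : union S A = S.
  by move: AS; rewrite -E /= finset.subsetUr.
apply: (tight_max Px).
- by move: Sx; rewrite inE => /eqP.
- by rewrite /= finset.subsetUl.
- rewrite /= vol_unionE [X in _ + X]/vol big1 ?addr0// => i; rewrite inE => /andP[iS iA].
  apply/eqP; apply: contraT => xi; have [B Bx /andP[iB AB]] := H i iA xi.
  have BS : (#|val B| <= #|val S|)%N by apply: Smax; rewrite /P Bx.
  case/orP: (chain_total Px (chain_tight _ Bx) (chain_tight _ Sx)) => sub.
    by rewrite (fintype.subsetP sub _ iB) in iS.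
  have /eqP E : val S == val B by rewrite eqEcard sub BS.
  by rewrite E iB in iS.
Qed.

End Support.

(** * Recovering the stratum from the supports *)

Definition pattern x A : {set edges_of A} := [set i | pi_map G g A x i != 0]%SET.

Lemma pattern_stratum x y : jewel G c x -> jewel G c y ->
  zero_set x = zero_set y -> tight_cores x = tight_cores y ->
  forall A, pattern x A = pattern y A.
Proof.
move=> Px Py /finset.setP zxy txy A; apply/finset.setP => i; rewrite !inE.
have := zxy (val i); rewrite !inE => xyi.
by apply/pi_map_neq0P/pi_map_neq0P => //; rewrite xyi txy.
Qed.

Lemma zero_set_pattern x y : jewel G c x -> jewel G c y ->
  (forall A, pattern x A = pattern y A) -> zero_set x \subset zero_set y.
Proof.
move=> Px Py pxy; apply/fintype.subsetP => i; rewrite !inE.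
apply: contraLR => /(pi_map_smallest Py) yi.
have /finset.setP/(_ (exist _ i (mem_smallest y i))) := pxy (smallest y i).
by rewrite !inE yi => /(pi_map_neq0P Px)[].
Qed.

(** Let [S] be tight at [x], and let [T] be the largest of the sets [smallest y i] for [i] in [S]
    with y_i nonzero. Coordinate [i] of pi_T is nonzero at [y], hence at [x], so the tight set [S]
    must contain [T]. As [T] contains the support of [y] in [S], both have the same volume at [y],
    and [tight_max] identifies them when [T] is tight. *)
Lemma tight_cores_pattern x y : jewel G c x -> jewel G c y ->
  (forall A, pattern x A = pattern y A) -> tight_cores x \subset tight_cores y.
Proof.
move=> Px Py pxy; apply/fintype.subsetP => S Sx.
have [i0 i0S yi0] := vol_gt0_ex Py S.
pose P i := (i \in val S) && (y i != 0).
have Pi0 : P i0 by rewrite /P i0S.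
case: (arg_maxnP (fun i => #|val (smallest y i)|) Pi0) => i /andP[iS yi] imax.
set T := smallest y i.
have ST j : j \in val S -> y j != 0 -> j \in val T.
  move=> jS yj; have le : (#|val (smallest y j)| <= #|val T|)%N.
    by apply: imax; rewrite /P jS.
  have := mem_smallest y j.
  case/orP: (chain_total Py (smallest_chain y j) (smallest_chain y i)) => sub.
    exact: (fintype.subsetP sub).
  suff /eqP E : val T == val (smallest y j) by rewrite E.
  by rewrite eqEcard sub le.
have TS : val T \subset val S.
  apply: contraT => nTS.
  have /finset.setP/(_ (exist _ i (mem_smallest y i))) := pxy T.
  rewrite !inE (pi_map_smallest Py yi) => /(pi_map_neq0P Px)[_ /(_ S iS nTS)].
  by rewrite Sx.
have volST : vol (val S) y = vol (val T) y.
  rewrite -(finset.setUidPr TS) vol_unionE [X in _ + X]/vol big1 ?addr0// => j.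
  by rewrite inE => /andP[jT jS]; apply/eqP; apply: contraNT jT; exact: ST.
have := smallest_chain y i; rewrite -/T in_chain => /predU1P[E|/eqP tT]; last first.
  by rewrite (tight_max Py tT TS volST) inE tT.
(* If [T] is [Top], so is [S], and its volume is 1 at both points. *)
have {}E : S = Top.
  by apply: val_inj; apply/eqP; rewrite finset.eqEsubset finset.subsetT -E TS.
by move: Sx; rewrite !inE E /= (jewel_top Px) (jewel_top Py).
Qed.

(** * Injectivity on a stratum *)

Lemma p_core_inj_stratum x y : jewel G c x -> jewel G c y ->
  zero_set x = zero_set y -> tight_cores x = tight_cores y ->
  (forall A, exists2 k : R, 0 < k & forall i : edges_of A, pi_map G g A y i = k * pi_map G g A x i) ->
  x = y.
Proof.
move=> Px Py /finset.setP zxy txy prop.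
have zE i : (x i == 0) = (y i == 0) by have := zxy i; rewrite !inE.
have /choice[k kP] A : exists k : R, 0 < k /\
    forall i : edges_of A, pi_map G g A y i = k * pi_map G g A x i.
  by have [k] := prop A; exists k.
pose u i := x i - y i.
have uS S : S \in chain x -> \sum_(i in val S) u i = 0.
  rewrite /u sumrB -!/(vol _ _) in_chain => /predU1P[->|/eqP tS].
    by rewrite /= (jewel_top Px) (jewel_top Py) subrr.
  have : S \in tight_cores y by rewrite -txy inE tS.
  by rewrite inE tS => /eqP ->; rewrite subrr.
pose l i := if x i == 0 then 0 else ln (x i) - ln (y i).
pose gv S z := ln (g (rk S) (vol (val S) z)).
(* Members of the chain never occur among the factors of pi at [smallest x i] (see [outside]), so
   the default 0 does not alter the increment of L_i, while it keeps all terms of the pairing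
   nonnegative. *)
pose a S := if S \in chain x then 0 else gv S x - gv S y.
have gpos S z : jewel G c z -> tight_cores x = tight_cores z -> S \notin chain x ->
    0 < g (rk S) (vol (val S) z).
  move=> Pz txz; rewrite in_chain negb_or => /andP[ST Sx].
  rewrite lt_neqAle eq_sym cutoff_eq0// cutoff_ge0// andbT.
  by have /finset.setP/(_ S) := txz; rewrite !inE => <-.
have outside i S : ~~ (val (smallest x i) \subset val S) -> i \in val S -> S \notin chain x.
  by move=> nsub iS; apply: contra nsub => Sx; exact: smallest_sub.
have ln_pi z i (H := exist _ i (mem_smallest x i) : edges_of (smallest x i)) :
    jewel G c z -> tight_cores x = tight_cores z -> z i != 0 ->
    0 < pi_map G g (smallest x i) z H /\ ln (pi_map G g (smallest x i) z H) = ln (z i) +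
    \sum_(S : cS | (i \in val S) && ~~ (val (smallest x i) \subset val S)) gv S z.
  move=> Pz txz zi; have z0 : 0 < z i by rewrite lt_neqAle eq_sym zi jewel_ge0.
  have gz S : (i \in val S) && ~~ (val (smallest x i) \subset val S) ->
      0 < g (rk S) (vol (val S) z).
    by move=> /andP[iS nsub]; apply: gpos => //; exact: outside nsub iS.
  by rewrite /pi_map/= mulr_gt0 ?prodr_gt0// lnM ?posrE ?prodr_gt0// ln_prod.
(* The factors k_A relating the two homogeneous coordinate vectors become the class constants
   -ln(k_A). *)
have ul i : u i * l i = 0.
  apply: (pairing_vanishes (mem_smallest x)
    (class_sum0 (smallest_chain x) (mem_smallest x)
      (fun S i Sx iS => smallest_sub Px Sx iS) uS) (l := l) (a := a)
    (t := fun A => - ln (k A))) => {i} [i|i|S].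
  - move=> ui; have xi : x i != 0.
      apply: contra ui => xi; have := xi; rewrite zE => yi.
      by rewrite /u (eqP xi) (eqP yi) subrr.
    have yi : y i != 0 by rewrite -zE.
    have [px lx] := ln_pi x i Px erefl xi; have [_ ly] := ln_pi y i Py txy yi.
    have [k0 kE] := kP (smallest x i).
    move: ly; rewrite kE lnM ?posrE// lx /l (negbTE xi) => H.
    rewrite (eq_bigr (fun S => gv S x - gv S y)) => [|S /andP[iS nsub]].
      by rewrite sumrB; move: H; lra.
    by rewrite /a (negbTE (outside i S nsub iS)).
  - rewrite /u /l; case: eqVneq => [_|xi]; first by rewrite mulr0.
    have yi : y i != 0 by rewrite -zE.
    have x0 : 0 < x i by rewrite lt_neqAle eq_sym xi jewel_ge0.
    have y0 : 0 < y i by rewrite lt_neqAle eq_sym yi jewel_ge0.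
    have [le|lt] := leP (x i) (y i).
      by rewrite mulr_le0// subr_le0// ler_ln.
    by rewrite mulr_ge0// subr_ge0 ?ler_ln// ltW.
  - rewrite /a; case: ifPn => [_|nS]; first by rewrite mul0r.
    rewrite /u sumrB -!/(vol _ _) /gv.
    have gx := gpos S x Px erefl nS; have gy := gpos S y Py txy nS.
    have ST : S != Top by move: nS; rewrite in_chain negb_or => /andP[].
    have [le|lt] := leP (vol (val S) x) (vol (val S) y).
      by rewrite mulr_le0// subr_le0// ler_ln ?posrE// cutoff_mono.
    by rewrite mulr_ge0// subr_ge0 ?ler_ln ?posrE ?cutoff_mono// ltW.
apply/funext => i; have := ul i; rewrite /u /l.
case: eqVneq => [xi _|xi]; first by apply/esym/eqP; rewrite xi -zE xi.
have yi : y i != 0 by rewrite -zE.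
have x0 : 0 < x i by rewrite lt_neqAle eq_sym xi jewel_ge0.
have y0 : 0 < y i by rewrite lt_neqAle eq_sym yi jewel_ge0.
move=> /eqP; rewrite mulf_eq0 !subr_eq0 => /orP[/eqP//|/eqP].
by apply: ln_inj; rewrite posrE.
Qed.

(** * The jewel as a polyhedron, and its open faces *)

Definition constraint : finType := ((Delta + coreset G) + bool)%type.

(** The equation x_Delta = 1 is encoded as two opposite inequalities indexed by [bool]; both are
    tight on the whole jewel, so they do not affect the strata. *)
Definition normal (j : constraint) (i : Delta) : R :=
  match j with
  | inl (inl k) => (i == k)%:R
  | inl (inr A) => (i \in val A)%:R
  | inr s => if s then 1 else -1
  end.

Definition level (j : constraint) : R :=
  match j with
  | inl (inl k) => 0
  | inl (inr A) => c (h1rank G (val A))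
  | inr s => if s then 1 else -1
  end.

Lemma dot_coord k (x : {ptws Delta -> R}) : dot (normal (inl (inl k))) x = x k.
Proof.
rewrite /dot (bigD1 k)//= eqxx mul1r big1 ?addr0// => i ik.
by rewrite (negbTE ik) mul0r.
Qed.

Lemma dot_core A (x : {ptws Delta -> R}) : dot (normal (inl (inr A))) x = vol (val A) x.
Proof.
rewrite /dot /vol [RHS]big_mkcond/=; apply: eq_bigr => i _.
by case: ifP; rewrite ?mul1r ?mul0r.
Qed.

Lemma dot_total (s : bool) (x : {ptws Delta -> R}) :
  dot (normal (inr s)) x = (if s then 1 else -1) * vol [set: Delta]%SET x.
Proof.
rewrite /dot /vol mulr_sumr; apply: eq_big => i //=.
by rewrite inE.
Qed.

Lemma jewel_polyhedron : jewel G c = polyhedron normal level.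
Proof.
apply/seteqP; split=> x /=.
  move=> [x0 x1 xA] [[k|A]|s]; first by rewrite dot_coord.
    by rewrite dot_core; exact: xA.
  by rewrite dot_total x1; case: s; rewrite ?mulr1.
move=> H; split=> [i||A].
- by have := H (inl (inl i)); rewrite dot_coord.
- have := H (inr true); have := H (inr false); rewrite !dot_total /= mul1r mulN1r.
  by rewrite lerN2 => h1 h2; apply/eqP; rewrite eq_le h1.
- by have := H (inl (inr A)); rewrite dot_core.
Qed.

Definition stratum (x : {ptws Delta -> R}) : set {ptws Delta -> R} :=
  [set y | [/\ jewel G c y, zero_set y = zero_set x &
              tight_cores y = tight_cores x]].

Lemma jewel_open_faces E : open_faces (jewel G c) E <->
  exists2 x, jewel G c x & E = stratum x.
Proof.
rewrite {1}jewel_polyhedron open_facesP -jewel_polyhedron.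
suff H x y : jewel G c x -> jewel G c y ->
    (tight normal level y = tight normal level x) <->
    (zero_set y = zero_set x /\ tight_cores y = tight_cores x).
  have SE x : jewel G c x ->
      [set y | jewel G c y /\ tight normal level y = tight normal level x] = stratum x.
    move=> Px; apply/seteqP; split=> y /=; first by move=> [Py /(H x y Px Py)[? ?]].
    by move=> [Py ? ?]; split=> //; apply/H.
  by split=> -[x Px ->]; exists x; rewrite // SE.
move=> Px Py; split=> [/finset.setP E0|[/finset.setP z /finset.setP t]].
  split; apply/finset.setP => i; rewrite !inE.
    by have := E0 (inl (inl i)); rewrite !inE !dot_coord.
  by have := E0 (inl (inr i)); rewrite !inE !dot_core.
apply/finset.setP => -[[k|A]|s]; rewrite !inE.
- by rewrite !dot_coord; have := z k; rewrite !inE.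
- by rewrite !dot_core; have := t A; rewrite !inE.
- by rewrite !dot_total; case: Px => _ -> _; case: Py => _ -> _.
Qed.

Lemma jewel_compact : compact (jewel G c).
Proof.
apply: (@subclosed_compact _ _ [set x : {ptws Delta -> R} | forall i, `[0, 1]%classic (x i)]).
- rewrite jewel_polyhedron.
  have -> : polyhedron normal level = \bigcap_(j in setT)
      ((fun x : {ptws Delta -> R} => dot (normal j) x) @^-1` [set t | level j <= t]).
    by apply/seteqP; split=> x H j => [_|]; exact: H.
  apply: closed_bigI => j _; apply: closed_comp; last exact: closed_ge.
  move=> x _; apply: (@DC_cont _ _ 0 setT) => //.
  apply: DC_sum => [|i _]; first exact: openT.
  by apply: DC_mul; [exact: openT|apply: DC_cst; exact: openT|apply: DC_coord; exact: openT].
- apply: (@tychonoff Delta (fun=> R) (fun=> `[0, 1]%classic)) => i.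
  exact: segment_compact.
- move=> x Px i; rewrite /= in_itv/= jewel_ge0//= -(jewel_top Px).
  by rewrite /vol (bigD1 i) ?inE//= lerDl sumr_ge0// => j _; exact: jewel_ge0.
Qed.

(** * The map [p_core] in barycentric coordinates *)

Definition phi x : {ptws {A : cS & edges_of A} -> R} := fun s =>
  pi_map G g (tag s) x (tagged s) / \sum_j pi_map G g (tag s) x j.

Lemma pi_map_sum_gt0 x A : jewel G c x -> 0 < \sum_j pi_map G g A x j.
Proof.
move=> Px; have [i iA] := pi_map_neq0 Px A.
rewrite (bigD1 i)//= ltr_wpDr ?sumr_ge0// => [j _|]; first exact: pi_map_ge0.
by rewrite lt_neqAle eq_sym iA pi_map_ge0.
Qed.

Definition idx A (i : edges_of A) : {A : cS & edges_of A} := existT _ A i.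

Lemma p_map_val x A : jewel G c x ->
  exists2 v : @nonzero R (edges_of A), p_map G g A x = line_of v &
    set_val v = pi_map G g A x.
Proof.
move=> Px; exists (insubd (@ones R m G A) (pi_map G g A x)) => //.
apply: insubdK; apply/mem_set; exact: pi_map_neq0.
Qed.

Lemma bary_p_core x : jewel G c x -> bary (p_core G g x) = phi x.
Proof.
move=> Px; apply/funext => s; rewrite /bary /p_core.
by have [v -> vE] := p_map_val (tag s) Px; rewrite hcoord_ratio vE.
Qed.

Lemma p_core_ge0 x : jewel G c x -> proj_prod_ge0 R G (p_core G g x).
Proof.
move=> Px A; have [v E vE] := p_map_val A Px; exists v => // i.
by rewrite vE pi_map_ge0.
Qed.

Lemma phi_neq0 x A (i : edges_of A) : jewel G c x ->
  (phi x (idx i) != 0) = (pi_map G g A x i != 0).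
Proof.
move=> Px; rewrite /phi /= mulf_eq0 invr_eq0 negb_or.
by rewrite (gt_eqF (pi_map_sum_gt0 A Px)) andbT.
Qed.

Lemma same_stratum x y : jewel G c x -> jewel G c y ->
  (forall A, pattern x A = pattern y A) ->
  zero_set x = zero_set y /\ tight_cores x = tight_cores y.
Proof.
move=> Px Py pxy; split; apply/eqP; rewrite finset.eqEsubset.
  by rewrite !zero_set_pattern.
by rewrite !tight_cores_pattern.
Qed.

(** Equal images have equal supports, so both points lie in one stratum; the ratio of the coordinate
    sums is the positive factor relating the two vectors pi_A. *)
Lemma phi_inj x y : jewel G c x -> jewel G c y -> phi x = phi y -> x = y.
Proof.
move=> Px Py xy.
have [|zxy txy] := same_stratum Px Py.
  move=> A; apply/finset.setP => i; rewrite !inE.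
  by rewrite -(phi_neq0 i Px) xy phi_neq0.
apply: p_core_inj_stratum => // A.
exists ((\sum_j pi_map G g A y j) / \sum_j pi_map G g A x j).
  by rewrite divr_gt0// pi_map_sum_gt0.
move=> i; have := congr1 (fun f => f (idx i)) xy; rewrite /phi/= => E.
rewrite mulrAC -mulrA E mulrC divfK// gt_eqF// pi_map_sum_gt0//.
Qed.

(** Classes C^k are taken on open sets, which calls for functions smooth on the whole line. [Top]
    contains every [A] and so never contributes a factor; zero serves as its extension. *)
Lemma ext_exists : exists e : cS -> R -> R, forall S, smooth1 (e S) /\
  (S != Top -> {in `[c (rk S), 1]%R, e S =1 g (rk S)}).
Proof.
suff /choice[e eP] : forall S, exists F, smooth1 F /\
    (S != Top -> {in `[c (rk S), 1]%R, F =1 g (rk S)}) by exists e.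
move=> S; have [ST|ST] := eqVneq S Top; last first.
  by have [[F [sF Fg]] _ _ _ _] := g_cutoff (rk_ltn ST); exists F.
exists (fun=> 0); split=> // k x.
have -> : derive1n k (fun=> 0 : R) = fun=> 0.
  elim: k => // k IH; rewrite derive1nS IH; apply/funext => t.
  exact: derive1_cst.
exact: derivable_cst.
Qed.

(** * Smooth extension of the map, the homeomorphism and the strata *)

Section Extension.
Variable e : cS -> R -> R.
Hypothesis e_smooth : forall S, smooth1 (e S).
Hypothesis e_g : forall S, S != Top -> {in `[c (rk S), 1]%R, e S =1 g (rk S)}.

(** Indexed by all edges rather than by those of [A], so that it can be summed over the classes of
    cl. *)
Definition pi_at A x i : R :=
  x i * \prod_(S : cS | (i \in val S) && ~~ (val A \subset val S)) e S (vol (val S) x).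

Definition pi_ext A x : {ptws edges_of A -> R} := fun i : edges_of A => pi_at A x (val i).

Arguments pi_ext : clear implicits.

Lemma pi_extE A x : jewel G c x -> pi_ext A x = pi_map G g A x.
Proof.
move=> Px; apply/funext => i; rewrite /pi_ext /pi_at /pi_map; congr (_ * _).
apply: eq_bigr => S /andP[_ /sub_neq_Top ST]; rewrite e_g//.
by have := vol_itv Px S; rewrite inE.
Qed.

Lemma DC_vol k (S : {set Delta}) : DC k setT (vol S : {ptws Delta -> R} -> R).
Proof.
by apply: DC_sum => [|i _]; [exact: openT|apply: DC_coord; exact: openT].
Qed.

Lemma DC_pi_at k A i : DC k setT (fun x => pi_at A x i).
Proof.
apply: DC_mul; [exact: openT|apply: DC_coord; exact: openT|].
apply: DC_prod => [|S _]; first exact: openT.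
by apply: DC_smooth1_comp; [exact: openT|exact: e_smooth|exact: DC_vol].
Qed.

Lemma DC_pi_ext k A (i : edges_of A) : DC k setT (fun x => pi_ext A x i).
Proof. exact: DC_pi_at. Qed.

Definition phi_ext x : {ptws {A : cS & edges_of A} -> R} := fun s =>
  pi_ext (tag s) x (tagged s) / \sum_j pi_ext (tag s) x j.

Lemma phi_extE x : jewel G c x -> phi_ext x = phi x.
Proof. by move=> Px; apply/funext => s; rewrite /phi_ext /phi !pi_extE. Qed.

Definition phi_dom : set {ptws Delta -> R} :=
  [set x | \prod_A \sum_j pi_ext A x j != 0].

Lemma phi_dom_open : open phi_dom.
Proof.
apply: open_neq0; apply: DC_prod => [|A _]; first exact: openT.
by apply: DC_sum => [|j _]; [exact: openT|exact: DC_pi_ext].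
Qed.

Lemma phi_dom_jewel x : jewel G c x -> phi_dom x.
Proof.
move=> Px; apply/prodf_neq0 => A _.
by rewrite pi_extE// gt_eqF// pi_map_sum_gt0.
Qed.

Lemma DC_phi_ext k s : DC k phi_dom (fun x => phi_ext x s).
Proof.
have oD := phi_dom_open.
apply: DC_mul => //; first by apply: DC_sub (DC_pi_ext k (tagged s)).
apply: DC_inv => //; first by move=> x /prodf_neq0; apply.
by apply: DC_sum => // j _; apply: DC_sub (DC_pi_ext k j).
Qed.

Lemma phi_continuous : {within jewel G c, continuous phi}.
Proof.
apply: (@subspace_eq_continuous _ _ _ phi_ext).
  by move=> x /set_mem Px; exact: phi_extE.
apply: continuous_in_subspaceT => x /set_mem Px.
apply: (@cvg_prod_topology _ _ (fun=> R) (nbhs x) phi_ext (phi_ext x)) => s.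
exact: (DC_cont (DC_phi_ext 0 s) (phi_dom_jewel Px)).
Qed.

(** On the jewel each component factors through a continuous lift to the nonzero vectors, followed
    by the quotient map. *)
Lemma p_core_continuous : {within jewel G c, continuous (p_core G g)}.
Proof.
apply/subspace_continuousP => x Px; apply: cvg_prod_topology => A.
pose v y : @nonzero R (edges_of A) := insubd (@ones R m G A) (pi_map G g A y).
have vE y : jewel G c y -> set_val (v y) = pi_ext A y.
  by move=> Py; rewrite pi_extE//; apply: insubdK; apply/mem_set; exact: pi_map_neq0.
suff vx : v @ within (jewel G c) (nbhs x) --> v x.
  have lc : @line_of R (edges_of A) @ nbhs (v x) --> line_of (v x).
    exact: (@pi_continuous _ {eq_quot (@proportional R (edges_of A))}%qT (v x)).
  exact: (cvg_comp _ _ vx lc).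
apply: cvg_nonzero => i; rewrite vE//.
apply: (@cvg_trans _ ((fun y => pi_ext A y i) @ within (jewel G c) (nbhs x))).
  by apply: fmap_within_eq => y /set_mem Py; rewrite vE.
apply: cvg_trans; first by apply: cvg_app; exact: cvg_within.
exact: (DC_cont (DC_pi_ext 0 i)).
Qed.

Lemma p_core_homeo : homeo_onto_image (jewel G c) (p_core G g).
Proof.
apply: (@homeo_of_chart {ptws Delta -> R} (proj_prod R G)
  {ptws {A : cS & edges_of A} -> R} (fun=> 0) (jewel G c) (p_core G g) (@bary R m G)).
- exact: jewel_compact.
- exact: hausdorff_ptws.
- exact: p_core_continuous.
- move=> x Px; apply: (@cvg_prod_topology _ _ (fun=> R)
    (nbhs (p_core G g x : proj_prod R G)) (@bary R m G) (bary (p_core G g x))) => s.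
  have [v vE vP] := p_map_val (tag s) Px.
  apply: (@continuous_comp _ _ _ (fun q : proj_prod R G => q (tag s)) (ratio (tagged s))).
    exact: (@proj_continuous _ (fun A => proj_space R (edges_of A)) (tag s)).
  rewrite [p_core G g x _]vE; apply: ratio_continuous.
  by rewrite vP gt_eqF// pi_map_sum_gt0.
- by move=> x y Px Py; rewrite !bary_p_core//; exact: phi_inj.
Qed.

Lemma p_core_pattern (B : forall A : cS, {set edges_of A}) x : jewel G c x ->
  (forall A, simplex_open_face (B A) (p_core G g x A)) <-> forall A, B A = pattern x A.
Proof.
move=> Px; split=> H A; have [v E vP] := p_map_val A Px.
  have := H A; rewrite /p_core E => /simplex_open_face_line_of ->.
    by apply/finset.setP => i; rewrite !inE vP.
  by move=> i; rewrite vP pi_map_ge0.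
rewrite /p_core E; apply/simplex_open_face_line_of.
  by move=> i; rewrite vP pi_map_ge0.
by rewrite H; apply/finset.setP => i; rewrite !inE vP.
Qed.

(** The [pattern] of a point names the open face of the product containing its image, and the strata
    of the jewel are exactly the nonempty level sets of [pattern]. *)
Lemma p_core_strata : stratum_preserving (open_faces (jewel G c))
  (induced_strata (proj_prod_open_faces R G) (p_core G g @` jewel G c)) (p_core G g).
Proof.
have key x : jewel G c x -> p_core G g @` stratum x = (p_core G g @` jewel G c) `&`
    [set q | forall A, simplex_open_face (pattern x A) (q A)].
  move=> Px; apply/seteqP; split=> q.
    move=> [y [Py zy ty] <-]; split; first by exists y.
    by apply/p_core_pattern => // A; exact: pattern_stratum.
  move=> [[y Py <-] /p_core_pattern pxy]; exists y => //.
  by have [] := same_stratum Px Py (pxy Py).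
apply/seteqP; split=> Z.
  move=> [E /jewel_open_faces[x Px ->] <-]; split; first by exists (p_core G g x), x.
  exists [set q | forall A, simplex_open_face (pattern x A) (q A)]; last exact: key.
  exists (pattern x) => // A; have [i iA] := pi_map_neq0 Px A.
  by apply/set0Pn; exists i; rewrite inE.
move=> [[q +] [W [B _ WE] ZE]]; rewrite ZE => -[[x Px <-]].
rewrite WE => /(p_core_pattern _ Px) BE; exists (stratum x).
  by apply/jewel_open_faces; exists x.
by rewrite key//; congr (_ `&` _); apply/seteqP; split=> r H A; have := H A; rewrite BE.
Qed.

(** * The smooth inverse on a stratum *)

Section LocalInverseOnStratum.
Variable x0 : {ptws Delta -> R}.
Hypothesis Px0 : jewel G c x0.
Local Notation cl := (smallest x0).

Definition class_pi A x : R := \sum_(i | (cl i == A) && (x0 i != 0)) pi_at A x i.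

Definition class_vol A x : R := \sum_(i | (cl i == A) && (x0 i != 0)) x i.

(* On the stratum of x0 the coordinates in zero_set x0 and the class volumes are
   constant, so that theta is a function of p_core there (see theta_stratum);
   unlike p_core it is a local diffeomorphism of the ambient space. *)
Definition theta x : {ptws Delta -> R} := fun i =>
  if x0 i == 0 then x i else pi_at (cl i) x i * (class_pi (cl i) x)^-1 * class_vol (cl i) x.

Definition theta_dom : set {ptws Delta -> R} :=
  [set x | \prod_(i | x0 i != 0) class_pi (cl i) x != 0].

Lemma DC_class_pi k A : DC k setT (class_pi A).
Proof. by apply: DC_sum => [|i _]; [exact: openT|exact: DC_pi_at]. Qed.

Lemma theta_dom_open : open theta_dom.
Proof.
apply: open_neq0; apply: DC_prod => [|A _]; first exact: openT.
exact: DC_class_pi.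
Qed.

Lemma DC_theta k i : DC k theta_dom (fun x => theta x i).
Proof.
have oD := theta_dom_open; rewrite /theta.
case E: (x0 i == 0); first exact: DC_coord.
apply: DC_mul => //; first apply: DC_mul => //.
- by apply: DC_sub (DC_pi_at k _ _).
- apply: DC_inv => //; first by move=> x /prodf_neq0; apply; rewrite E.
  by apply: DC_sub (DC_class_pi k _).
- by apply: DC_sum => // j _; exact: DC_coord.
Qed.

Lemma coord_gt0 i : x0 i != 0 -> 0 < x0 i.
Proof. by move=> xi; rewrite lt_neqAle eq_sym xi jewel_ge0. Qed.

Lemma pi_at_gt0 i : x0 i != 0 -> 0 < pi_at (cl i) x0 i.
Proof.
move=> xi; have := pi_map_smallest Px0 xi; rewrite -(pi_extE _ Px0).
rewrite lt_neqAle eq_sym => -> /=.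
have := pi_map_ge0 Px0 (exist _ i (mem_smallest x0 i) : edges_of (cl i)).
by rewrite -(pi_extE _ Px0).
Qed.

Lemma class_pi_gt0 i : x0 i != 0 -> 0 < class_pi (cl i) x0.
Proof.
move=> xi; rewrite /class_pi (bigD1 i) ?eqxx//= ltr_wpDr ?pi_at_gt0//.
by apply: sumr_ge0 => j /andP[/andP[/eqP <- xj] _]; exact/ltW/pi_at_gt0.
Qed.

Lemma class_vol_gt0 i : x0 i != 0 -> 0 < class_vol (cl i) x0.
Proof.
move=> xi; rewrite /class_vol (bigD1 i) ?eqxx//= ltr_wpDr ?coord_gt0//.
by apply: sumr_ge0 => j _; exact: jewel_ge0.
Qed.

Lemma theta_dom0 : theta_dom x0.
Proof. by apply/prodf_neq0 => i xi; rewrite gt_eqF// class_pi_gt0. Qed.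

(** A linear map recovering [theta] from [phi] on the stratum: the class volumes, constant there,
    are frozen at their values at [x0]. *)
Definition from_phi (q : {ptws {A : cS & edges_of A} -> R}) : {ptws Delta -> R} :=
  fun i => if x0 i == 0 then 0
    else q (@idx (cl i) (exist _ i (mem_smallest x0 i))) * class_vol (cl i) x0.

(** Class volumes are constant on the stratum by [class_sum0]. Moreover [class_pi (cl i)] is the
    full coordinate sum of pi at [cl i]: if [j] lies in [cl i] but [cl j] is smaller, then [cl j] is
    tight and its factor kills coordinate [j]. *)
Lemma theta_stratum y : stratum x0 y -> theta y = from_phi (phi y).
Proof.
move=> [Py zy ty]; apply/funext => i; rewrite /theta /from_phi.
have zE j : (y j == 0) = (x0 j == 0) by have /finset.setP/(_ j) := zy; rewrite !inE.
case: ifPn => xi; first by apply/eqP; rewrite zE.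
have volE : class_vol (cl i) y = class_vol (cl i) x0.
  have := class_sum0 (smallest_chain x0) (mem_smallest x0)
    (fun S i Sx iS => smallest_sub Px0 Sx iS) (u := fun j => y j - x0 j) _ (cl i).
  have H S : S \in chain x0 -> \sum_(j in val S) (y j - x0 j) = 0.
    rewrite sumrB -!/(vol _ _) in_chain => /predU1P[->|/eqP tS].
      by rewrite /= (jewel_top Px0) (jewel_top Py) subrr.
    have : S \in tight_cores y by rewrite ty inE tS.
    by rewrite inE tS => /eqP ->; rewrite subrr.
  move=> /(_ H); rewrite (bigID (fun j => x0 j != 0))/= [X in _ + X]big1 => [|j].
    by rewrite addr0 sumrB => /eqP; rewrite subr_eq0 => /eqP.
  by move=> /andP[_ /negPn xj]; rewrite (eqP xj); move: xj; rewrite -zE => /eqP ->; rewrite subrr.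
rewrite volE; congr (_ * _); rewrite /phi/= -!(pi_extE _ Py); congr (_ / _).
transitivity (\sum_(j in val (cl i)) pi_at (cl i) y j); last exact: big_sub.
rewrite /class_pi big_mkcond [RHS]big_mkcond; apply: eq_bigr => j _ /=.
case: ifPn => [/andP[/eqP <- _]|]; first by rewrite mem_smallest.
rewrite negb_and negbK -zE => H; case: ifPn => // ji.
apply/esym/eqP; apply: contraT => nz.
have : pi_map G g (cl i) y (exist _ j ji) != 0 by rewrite -(pi_extE _ Py).
move=> /(pi_map_neq0P Py)[/= yj nt]; case/orP: H => [clj|]; last by rewrite (negbTE yj).
have sub : val (cl j) \subset val (cl i).
  by apply: smallest_sub => //; exact: smallest_chain.
have nsub : ~~ (val (cl i) \subset val (cl j)).
  apply: contra clj => sub'; apply/eqP/val_inj/eqP.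
  by rewrite finset.eqEsubset sub sub'.
have := nt _ (mem_smallest x0 j) nsub; rewrite ty.
have := smallest_chain x0 j; rewrite in_setU1 => /predU1P[E|->//].
by rewrite E finset.subsetT in nsub.
Qed.

(** Along the line x0 + t w, the class sums of [w] vanish because the coordinates of [theta] in a
    class add up to the class volume, and the logarithmic derivatives [lam] are constant on classes.
    The pairing then consists of the w_i^2 / x_i and of nonnegative multiples of the w_S^2, so its
    vanishing gives w = 0. *)
Lemma theta_jacobian (w : Delta -> R) :
  (forall b, \sum_a partial a (fun x => theta x b) x0 * w a = 0) -> forall a, w a = 0.
Proof.
move=> Jw.
pose gam (t : R) : {ptws Delta -> R} := fun i => x0 i + t * w i.
have gam0 : gam 0 = x0 by apply/funext => i; rewrite /gam mul0r addr0.
have dgam i : is_derive (0 : R) (1 : R) (fun t => gam t i) (w i).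
  exact: is_derive_affine.
have dtheta b : is_derive (0 : R) (1 : R) (fun t => theta (gam t) b) 0.
  have d0 : theta_dom (gam 0) by rewrite gam0; exact: theta_dom0.
  have := DC_curve theta_dom_open (DC_theta 1 b) d0 dgam.
  by rewrite gam0 Jw.
have near_dom : \forall t \near (0 : R), theta_dom (gam t).
  have gc : gam @ (0 : R) --> gam 0.
    apply: (@cvg_prod_topology _ _ (fun=> R) _ gam (gam 0)) => i.
    have cg : {for (0 : R), continuous (fun t : R => gam t i : R)}.
      by apply: differentiable_continuous; apply/derivable1_diffP; case: (dgam i).
    exact: cg.
  apply: gc; apply: open_nbhs_nbhs; split; first exact: theta_dom_open.
  by rewrite gam0; exact: theta_dom0.
have w0 i : x0 i == 0 -> w i = 0.
  move=> xi; apply: (is_derive_near _ (dgam i) (dtheta i)).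
  by near=> t; rewrite /theta xi.
have dvol S : is_derive (0 : R) (1 : R) (fun t => vol (val S) (gam t)) (\sum_(i in val S) w i).
  by apply: is_derive_bigsum => i _; exact: dgam.
have outside i S : (i \in val S) && ~~ (val (cl i) \subset val S) -> S \notin chain x0.
  by move=> /andP[iS]; apply: contra => Sx; exact: smallest_sub.
have e_gt0 S : S \notin chain x0 -> 0 < e S (vol (val S) x0).
  rewrite in_chain negb_or => /andP[ST nt].
  rewrite e_g//; last by have := vol_itv Px0 S; rewrite inE.
  by rewrite lt_neqAle eq_sym cutoff_eq0// nt cutoff_ge0.
pose dS S := derive1 (e S) (vol (val S) x0) * \sum_(i in val S) w i.
have de S : is_derive (0 : R) (1 : R) (fun t => e S (vol (val S) (gam t))) (dS S).
  have H : is_derive (vol (val S) (gam 0)) (1 : R) (e S) (derive1 (e S) (vol (val S) x0)).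
    by rewrite gam0; exact: smooth1_is_derive.
  exact: (@is_derive1_comp R (e S) (fun t => vol (val S) (gam t)) _ _ _ H (dvol S)).
(* The derivative of L_i along [w]. *)
pose lam i := w i / x0 i + \sum_(S : cS | (i \in val S) && ~~ (val (cl i) \subset val S))
    dS S / e S (vol (val S) x0).
have dpi i : x0 i != 0 ->
    is_derive (0 : R) (1 : R) (fun t => pi_at (cl i) (gam t) i) (pi_at (cl i) x0 i * lam i).
  move=> xi; have := is_derive_mul (dgam i) (@is_derive_prod R cS (index_enum cS)
    (fun S => (i \in val S) && ~~ (val (cl i) \subset val S))
    (fun S t => e S (vol (val S) (gam t))) dS 0 _).
  rewrite gam0 => /(_ _)/is_derive_eq; apply.
    by move=> S /outside Sx; split; [rewrite gt_eqF// e_gt0|exact: de].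
  rewrite /pi_at /lam; set P := \prod_(_ | _) _; set Q := \sum_(_ | _) _.
  by field.
pose dclass A := \sum_(i | (cl i == A) && (x0 i != 0)) pi_at A x0 i * lam i.
have dclassP A : is_derive (0 : R) (1 : R) (fun t => class_pi A (gam t)) (dclass A).
  by apply: is_derive_bigsum => i /andP[/eqP <- xi]; exact: dpi.
have dclass_vol A : is_derive (0 : R) (1 : R) (fun t => class_vol A (gam t))
    (\sum_(i | (cl i == A) && (x0 i != 0)) w i).
  by apply: is_derive_bigsum => i _; exact: dgam.
have class_w i : x0 i != 0 -> \sum_(j | (cl j == cl i) && (x0 j != 0)) w j = 0.
  move=> xi; have D : is_derive (0 : R) (1 : R) (fun t => \sum_(j | (cl j == cl i) && (x0 j != 0))
      theta (gam t) j) (\sum_(j | (cl j == cl i) && (x0 j != 0)) 0).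
    by apply: is_derive_bigsum => j _; exact: dtheta.
  rewrite big1// in D; apply: (is_derive_near _ (dclass_vol (cl i)) D).
  near=> t; have /prodf_neq0/(_ i xi) Vt : theta_dom (gam t) by near: t.
  transitivity (\sum_(j | (cl j == cl i) && (x0 j != 0))
      pi_at (cl i) (gam t) j * ((class_pi (cl i) (gam t))^-1 * class_vol (cl i) (gam t))).
    by rewrite -mulr_suml -/(class_pi _ _) mulVKf.
  by apply: eq_bigr => j /andP[/eqP jE xj]; rewrite /theta (negbTE xj) jE mulrA.
(* The formula for [theta] is differentiated with its denominator cleared; the derivatives of
   [theta] and of the class volume are zero. *)
have lamE i : x0 i != 0 -> lam i = dclass (cl i) / class_pi (cl i) x0.
  move=> xi.
  have D1 := is_derive_mul (dtheta i) (dclassP (cl i)).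
  have D2 := is_derive_mul (dpi i xi) (dclass_vol (cl i)).
  have V0 := class_pi_gt0 xi; have X0 := class_vol_gt0 xi; have p0 := pi_at_gt0 xi.
  have N : \forall t \near (0 : R), theta (gam t) i * class_pi (cl i) (gam t) =
      pi_at (cl i) (gam t) i * class_vol (cl i) (gam t).
    near=> t; have /prodf_neq0/(_ i xi) Vt : theta_dom (gam t) by near: t.
    by rewrite /theta (negbTE xi); field.
  have := is_derive_near N D1 D2; rewrite gam0 class_w// !mulr0 addr0 add0r.
  rewrite /theta (negbTE xi) => H.
  apply: (mulfI (x := class_vol (cl i) x0 * pi_at (cl i) x0 i)).
    by rewrite mulf_neq0// gt_eqF.
  by rewrite -mulrA -H; field; rewrite gt_eqF.
have class0 A : \sum_(i | cl i == A) w i = 0.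
  rewrite (bigID (fun j => x0 j != 0))/= [X in _ + X]big1 => [|j]; last first.
    by move=> /andP[_ /negPn]; exact: w0.
  rewrite addr0; have [[i /andP[/eqP <- xi]]|nex] := pselect (exists i, (cl i == A) && (x0 i != 0)).
    exact: class_w.
  by rewrite big1// => i iA; exfalso; apply: nex; exists i.
have wl a : w a * (if x0 a == 0 then 0 else w a / x0 a) = 0.
  apply: (pairing_vanishes (mem_smallest x0) class0
    (l := fun i => if x0 i == 0 then 0 else w i / x0 i)
    (a := fun S => if S \in chain x0 then 0 else dS S / e S (vol (val S) x0))
    (t := fun A => dclass A / class_pi A x0)) => {a} [i wi|i|S].
  - have xi : x0 i != 0 by apply: contra wi => /w0 ->.
    rewrite (negbTE xi) -lamE//; congr (_ + _); apply: eq_bigr => S /outside.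
    by move=> /negbTE ->.
  - case: ifPn => xi; first by rewrite mulr0.
    by rewrite mulrA -expr2 divr_ge0 ?sqr_ge0 ?jewel_ge0.
  - case: ifPn => Sx; first by rewrite mul0r.
    have v0 := e_gt0 S Sx; rewrite /dS.
    set d := derive1 _ _; set s := \sum_(_ in _) _; set v := e S _.
    rewrite (_ : d * s / v * s = d * (s ^+ 2 / v)); last by field; rewrite gt_eqF.
    apply: mulr_ge0; last by rewrite divr_ge0 ?sqr_ge0 ?(ltW v0).
    move: Sx; rewrite in_chain negb_or => /andP[ST nt].
    have dS_ : is_derive (vol (val S) x0) (1 : R) (e S) d by exact: smooth1_is_derive.
    apply: (derive_ge0_left dS_ (a := c (rk S))).
      by rewrite lt_neqAle eq_sym nt jewel_core.
    move=> y cy yv; have v1 := jewel_le1 Px0 S.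
    rewrite !e_g// ?in_itv/= ?cy ?(le_trans yv)// ?jewel_core//.
    exact: cutoff_nondecreasing (g_cutoff (rk_ltn ST)) cy yv v1.
move=> a; have := wl a; case: ifPn => [/w0 ->//|xa].
by move=> /eqP; rewrite mulrA mulf_eq0 invr_eq0 (negbTE xa) orbF mulf_eq0 orbb => /eqP.
Unshelve. all: by end_near.
Qed.

Lemma DC_from_phi k i : DC k setT (fun q => from_phi q i).
Proof.
rewrite /from_phi; case: (x0 i == 0); first by apply: DC_cst; exact: openT.
by apply: DC_mul; [exact: openT|apply: DC_coord; exact: openT|apply: DC_cst; exact: openT].
Qed.

(** [F] is the local inverse of [theta] composed with [from_phi]. It recovers [y] only near [x0];
    [compact_separation] shrinks [U] so that every [y] of the jewel with [phi y] in [U] is that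
    near. *)
Lemma phi_local_inverse : exists (U : set {ptws {A : cS & edges_of A} -> R})
    (F : {ptws {A : cS & edges_of A} -> R} -> {ptws Delta -> R}),
  [/\ open U, U (phi x0), (forall i k, Ck k U (fun q => F q i)) &
      forall y, stratum x0 y -> U (phi y) -> F (phi y) = y].
Proof.
have oD := theta_dom_open.
pose D := [set x | theta_dom x /\ \det (jacobian theta x) != 0].
have oDJ : open D.
  apply: open_neq0_in => //; apply: DC_det => // b a.
  exact: (DC_jacobian oD DC_theta).
have D0 : D x0.
  by split; [exact: theta_dom0|apply: jacobian_det_neq0; exact: theta_jacobian].
have DU k b : DC k D (fun x => theta x b).
  by apply: DC_sub (DC_theta k b) => x [].
have [V [h [oV V0 hV hK]]] := inverse_function oDJ D0 DU (fun x Dx => Dx.2).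
have [Q [oQ Q0 QK]] := compact_separation jewel_compact phi_continuous phi_inj
  (@hausdorff_ptws R _) Px0 hK.
have Ph0 : stratum x0 x0 by [].
have oF : open (from_phi @^-1` V).
  apply: open_comp => // q _; apply: (@cvg_prod_topology _ _ (fun=> R) (nbhs q) from_phi) => i.
  exact: (DC_cont (DC_from_phi 0 i)).
have oQV : open (Q `&` from_phi @^-1` V) by exact: openI.
exists (Q `&` from_phi @^-1` V), (h \o from_phi); split => //.
- by split; rewrite //= -theta_stratum.
- move=> i k; apply: DC_Ck.
  apply: (DC_comp oV oQV (hV k i) (h := from_phi)) => [j|q []//].
  by apply: DC_sub (DC_from_phi k j).
- move=> y Ey [Qy]; have [Py _ _] := Ey.
  by rewrite /= -theta_stratum// => Vy; exact: (QK y Py Qy).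
Qed.

End LocalInverseOnStratum.

Lemma stratum_eq x y : stratum x y -> stratum y = stratum x.
Proof.
by move=> [Py zy ty]; apply/seteqP; split=> z [Pz zz tz]; split; rewrite ?zz ?tz ?zy ?ty.
Qed.

(** The inverse is chosen once on the whole image, by injectivity of [phi]; near each point of the
    image of the stratum it agrees with a local inverse [F], which is its smooth extension. *)
Lemma p_core_diffeo E : open_faces (jewel G c) E -> p_core_diffeo_on G g E.
Proof.
move=> /jewel_open_faces[x0 Px0 ->]; split.
- by rewrite image_comp.
- move=> x [Px _ _]; exists phi_dom, phi_ext; split.
  + exact: phi_dom_open.
  + exact: phi_dom_jewel.
  + by move=> s k; exact/DC_Ck/DC_phi_ext.
  + by move=> y [Py _ _] _; rewrite /= phi_extE// bary_p_core.
have /choice[h hP] (q : {ptws {A : cS & edges_of A} -> R}) :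
    exists x, forall z, jewel G c z -> phi z = q -> x = z.
  have [[x [Px xq]]|nex] := pselect (exists x, jewel G c x /\ phi x = q).
    by exists x => z Pz zq; apply: phi_inj => //; rewrite xq zq.
  by exists (fun=> 0) => z Pz zq; exfalso; apply: nex; exists z.
exists h; split=> [x [Px _ _]|_ [_ [x Ex <-] <-]].
  by apply: hP => //=; rewrite bary_p_core.
have [Px _ _] := Ex; have [U [F [oU Ux sF FK]]] := phi_local_inverse Px.
exists U, F; split=> //; first by rewrite bary_p_core.
move=> _ [_ [y Ey <-] <-]; have [Py _ _] := Ey; rewrite bary_p_core// => Uy.
rewrite FK//; last by rewrite (stratum_eq Ex).
by apply/esym; exact: hP.
Qed.

End Extension.
End JewelFacts.

Theorem theorem7p12 (R : realType) (n : nat) (n_ge2 : (2 <= n)%N) :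
  exists2 eps : R, 0 < eps &
  forall (m : nat) (G : graph m),
    connected_graph G ->
    h1rank G [set: 'I_m.+1]%SET = n ->
    (forall v : vertex G, valence v != 1%N /\ valence v != 2%N) ->
    (forall i : 'I_m.+1, ~~ separating G i) ->
  forall c : nat -> R,
    0 < c 1%N ->
    (forall r : nat, (1 <= r < n)%N ->
       2%:R * c r < c r.+1 /\ c r < eps * c r.+1) ->
    c n < eps ->
  forall g : nat -> R -> R,
    (forall r : nat, (1 <= r < n)%N -> cutoff (c r) (c r.+1) (g r)) ->
  [/\ p_core G g @` jewel G c `<=` proj_prod_ge0 R G,
      homeo_onto_image (jewel G c) (p_core G g),
      stratum_preserving (open_faces (jewel G c))
        (induced_strata (proj_prod_open_faces R G)
           (p_core G g @` jewel G c))
        (p_core G g) &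
      forall E, open_faces (jewel G c) E -> p_core_diffeo_on G g E].
Proof.
exists 1 => // m G _ rankG _ no_sep c c1 c_step _ g g_cutoff.
have c_double r : (1 <= r < n)%N -> 2%:R * c r < c r.+1 by case/c_step.
have [e eP] := ext_exists rankG no_sep g_cutoff.
have e_smooth S : smooth1 (e S) := (eP S).1.
split.
- by move=> _ [x Px <-]; exact: (p_core_ge0 rankG no_sep c1 c_double g_cutoff).
- apply: (p_core_homeo (no_sep := no_sep) rankG c1 c_double g_cutoff e_smooth) => S.
  exact: (eP S).2.
- exact: (p_core_strata rankG no_sep c1 c_double g_cutoff).
- apply: (p_core_diffeo (no_sep := no_sep) rankG c1 c_double g_cutoff e_smooth) => S.
  exact: (eP S).2.
Qed.
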